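(* Let $r>0$ and $\theta>0$ be fixed, and for each $\sigma>0$ let $V_{r,\theta,\sigma}\sim \mathrm{VG}(r,\theta,\sigma,0)$. Then the function $\sigma\mapsto \operatorname{Med}(V_{r,\theta,\sigma})$ is strictly decreasing on $(0,\infty)$. Consequently, if $G\sim\Gamma(r/2,(2\theta)^{-1})$, then $$\operatorname{Med}(V_{r,\theta,\sigma})<\operatorname{Med}(G),\qquad \sigma>0.$$ Moreover, $$\lim_{\sigma\to\infty}\operatorname{Med}(V_{r,\theta,\sigma})=\begin{cases}(r-1)\theta, & r>1,\\ 0, & 0<r\le 1.\end{cases}$$ Therefore, for $r>0$ and every $\sigma>0$, $$\max\{0,(r-1)\theta\}<\operatorname{Med}(V_{r,\theta,\sigma})<r\theta e^{-2/(3r)}<\left(r-\frac{2}{3}+\frac{2}{9r}\right)\theta,$$ and, for $r\ge 2$ and every $\sigma>0$, $$\operatorname{Med}(V_{r,\theta,\sigma})\le (r+2\log(2)-2)\theta.$$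
   Context: For $r>0$, $\theta\in\mathbb{R}$, $\sigma>0$, the variance-gamma distribution $\mathrm{VG}(r,\theta,\sigma,0)$ is the distribution on $\mathbb{R}$ with density $$p(x)=\frac{1}{\sigma\sqrt{\pi}\,\Gamma(r/2)}e^{\theta x/\sigma^2}\left(\frac{|x|}{2\sqrt{\theta^2+\sigma^2}}\right)^{(r-1)/2}K_{\frac{r-1}{2}}\left(\frac{\sqrt{\theta^2+\sigma^2}}{\sigma^2}|x|\right),\qquad x\in\mathbb{R},$$ where $K_\nu$ is the modified Bessel function of the second kind. For $r>0$ and $\lambda>0$, $\Gamma(r,\lambda)$ denotes the gamma distribution with shape $r$ and rate $\lambda$, i.e. with density $\frac{\lambda^r}{\Gamma(r)}x^{r-1}e^{-\lambda x}$, $x>0$. The median of a real-valued random variable $X$ is $\operatorname{Med}(X)=\inf\{x\in\mathbb{R}: P(X\le x)\ge 1/2\}$. *)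

(* Defs.v *)
From HB Require Import structures.
From mathcomp Require Import all_boot all_order all_algebra.
From mathcomp Require Import all_classical all_reals all_analysis.

Set Implicit Arguments.
Unset Strict Implicit.
Unset Printing Implicit Defensive.

Import Order.TTheory GRing.Theory Num.Theory.
Import numFieldNormedType.Exports.

Local Open Scope classical_set_scope.
Local Open Scope ring_scope.

Section special_functions.
Context {R : realType}.
Implicit Types a nu x : R.

Definition gamma_fun a : R :=
  \int[lebesgue_measure]_(x in `]0, +oo[) (x `^ (a - 1) * expR (- x)).

Definition cosh x : R := (expR x + expR (- x)) / 2.

(* Modified Bessel function of the second kind, meaningful for x > 0, by its
   integral representation
   K_nu(x) = int_0^oo exp(- x cosh t) cosh (nu t) dt (DLMF 10.32.9).
   At x = 0 the integral diverges and the real-valued integral returns 0. *)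
Definition besselK nu x : R :=
  \int[lebesgue_measure]_(t in `]0, +oo[) (expR (- (x * cosh t)) * cosh (nu * t)).

End special_functions.

Section densities.
Context {R : realType}.
Implicit Types r theta sigma lambda x : R.

(* The formula has no meaning at x = 0, where it may have a pole; the value
   taken there does not matter, {0} being a Lebesgue null set. *)
Definition vg_pdf r theta sigma x : R :=
  (sigma * Num.sqrt pi * gamma_fun (r / 2))^-1
  * expR (theta * x / sigma ^+ 2)
  * (`|x| / (2 * Num.sqrt (theta ^+ 2 + sigma ^+ 2))) `^ ((r - 1) / 2)
  * besselK ((r - 1) / 2)
      (Num.sqrt (theta ^+ 2 + sigma ^+ 2) / sigma ^+ 2 * `|x|).

(* shape r, rate lambda *)
Definition gamma_pdf r lambda x : R :=
  if 0 < x then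
    lambda `^ r / gamma_fun r * x `^ (r - 1) * expR (- (lambda * x))
  else 0.

End densities.

Section random_variables.
Context d {T : measurableType d} {R : realType} {P : probability T R}.
Implicit Types X : {RV P >-> R}.

Definition has_density X (p : R -> R) : Prop :=
  forall A : set R, measurable A ->
    distribution P X A = (\int[lebesgue_measure]_(x in A) (p x)%:E)%E.

Definition VG_distributed X (r theta sigma : R) : Prop :=
  has_density X (vg_pdf r theta sigma).

Definition gamma_distributed X (r lambda : R) : Prop :=
  has_density X (gamma_pdf r lambda).

Definition median X : R := inf [set x : R | ((1 / 2)%:E <= cdf X x)%E].

End random_variables.

(* Main.v *)
Require Import Defs.
From HB Require Import structures.
From mathcomp Require Import all_boot all_order all_algebra.
From mathcomp Require Import all_classical all_reals all_analysis.
From mathcomp Require Import ring lra.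
From mathcomp Require Import measurable_realfun.

(** The variance-gamma variable is a normal mixture,
    V = theta S + sigma sqrt(S) Z, where S has the gamma distribution of shape
    a = r/2 and rate 1/2 and Z is an independent standard normal variable. Its
    median is positive, because the conditional mean theta S is. To locate
    the median, fix y > 0, write S = 2y exp(-t) and compare V with
    2 theta y. The density of t is proportional to
    kern(t) = exp(-at - y exp(-t)), and conditionally on t the inequality
    V <= 2 theta y concerns a Gaussian variable and a threshold that is a
    multiple of lambda delta(t), where delta(t) = exp(t/2) - exp(-t/2) and
    lambda = theta sqrt(y)/sigma. As delta is odd, pairing t with -t shows
    that P(V <= 2 theta y) - 1/2 has the sign of

      I(lambda) = integral over t > 0 of W(lambda delta(t)) (kern(t) - kern(-t)),

    where W(z) is the Gaussian mass between -z and z ([vg_cdf_ge_half]). The same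
    integral with the constant weight 1 decides whether the median of
    theta S is at most 2 theta y ([gamma_cdf_ge_half]).

    The factor kern(t) - kern(-t) changes sign at most once on the half-line,
    from negative to positive, because y (exp(t) - exp(-t)) - 2at is convex.
    Hence replacing a weight by another one that increases relative to it
    keeps the integral nonnegative, and even makes it positive
    ([crossing_integral]). Along

      1,  W(lambda delta) with lambda decreasing,  delta

    the weights increase relatively to one another. The first step says that
    the median of V lies below that of theta S, and the comparison of two
    values of lambda says that it decreases when sigma increases. In the
    last step, the two halves of the integrand with weight delta are exact
    derivatives for y = a - 1/2, and the integral vanishes there; then 2
    theta y is (r - 1) theta. So I(lambda) is negative for this y and all
    sigma, which is the lower bound; and for every larger y > 0 it is
    positive for small lambda, because W(lambda delta) is nearly a multiple
    of lambda delta. This gives the limit, also for r <= 1, where any y > 0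
    qualifies.

    The upper bounds are bounds for the median of a gamma distribution. When
    the shape is y, parametrize the points of equal density on the logarithmic
    scale by their distance tau: they lie
    u1 = ln((exp(tau) - 1)/tau) below and u2 = tau - u1 above ln y.
    Both halves of the integral then carry the same weight, and only the
    derivatives of u1 and u2 have to be compared. This yields
    r theta exp(-2/(3r)) after a translation of t ([gamma_median_exp_bound]).
    For shape y + 1 - ln 2, the same substitution leaves a factor that does not
    depend on y and changes sign once; the argument on weights compares
    shape a >= 1 with shape 1, where the median is known to be ln 2
    ([gamma_median_linear_bound]). *)

Set Implicit Arguments.
Unset Strict Implicit.
Unset Printing Implicit Defensive.

Import Order.TTheory GRing.Theory Num.Theory.
Import numFieldNormedType.Exports.

Local Open Scope classical_set_scope.
Local Open Scope ring_scope.

(** * Derivatives and sign changes *)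

Section derivative_rules.
Context {R : realType}.
Implicit Types (f g : R -> R) (x a b c : R).

Lemma der_cst c x : is_derive x 1 (fun=> c) 0.
Proof. exact: is_derive_cst. Qed.

Lemma der_id x : is_derive x 1 (fun u : R => u) 1.
Proof. exact: is_derive_id. Qed.

Lemma der_add f g x a b : is_derive x 1 f a -> is_derive x 1 g b ->
  is_derive x 1 (fun u => f u + g u) (a + b).
Proof. by move=> fa gb; exact: is_deriveD. Qed.

Lemma der_opp f x a : is_derive x 1 f a -> is_derive x 1 (fun u => - f u) (- a).
Proof. by move=> fa; exact: is_deriveN. Qed.

Lemma der_mul f g x a b : is_derive x 1 f a -> is_derive x 1 g b ->
  is_derive x 1 (fun u => f u * g u) (f x * b + g x * a).
Proof. by move=> fa gb; exact: is_deriveM. Qed.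

Lemma der_exp f x a : is_derive x 1 f a ->
  is_derive x 1 (fun u => expR (f u)) (a * expR (f x)).
Proof.
move=> fa; rewrite mulrC.
exact: (is_derive1_comp (is_derive_expR (f x)) fa).
Qed.

Lemma der_ln f x a : 0 < f x -> is_derive x 1 f a ->
  is_derive x 1 (fun u => ln (f u)) (a / f x).
Proof.
move=> fx0 fa; rewrite mulrC.
exact: (is_derive1_comp (is_derive1_ln fx0) fa).
Qed.

Lemma der_inv f x a : f x != 0 -> is_derive x 1 f a ->
  is_derive x 1 (fun u => (f u)^-1) (- a / f x ^+ 2).
Proof.
move=> fx0 fa; rewrite mulNr mulrC -mulNr.
by have := is_deriveV fx0 fa.
Qed.

Lemma der_sqr f x a : is_derive x 1 f a ->
  is_derive x 1 (fun u => f u ^+ 2) (2 * f x * a).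
Proof.
move=> fa; apply: (is_derive_eq (der_mul fa fa)); ring.
Qed.

Lemma der_continuous f x a : is_derive x 1 f a -> {for x, continuous f}.
Proof.
move=> fa; apply: differentiable_continuous; apply/derivable1_diffP.
exact: (@ex_derive _ _ _ _ _ _ _ fa).
Qed.

Lemma der_derive1 f x a : is_derive x 1 f a -> derive1 f x = a.
Proof. by move=> fa; rewrite derive1E (@derive_val _ _ _ _ _ _ _ fa). Qed.

Lemma der_eq f x a b : is_derive x 1 f a -> a = b -> is_derive x 1 f b.
Proof. by move=> fa <-. Qed.

End derivative_rules.

(** [der] reduces [is_derive x 1 f l] to an identity between [l] and the
    derivative computed from the rules. Conditions of positivity or of
    nonvanishing come first. *)
Ltac der_step := lazymatch goal with
 | |- is_derive _ _ (fun _ => ?c) _ => notypeclasses refine (der_cst c _)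
 | |- is_derive _ _ (fun u => u) _ => notypeclasses refine (der_id _)
 | |- is_derive _ _ (fun u => _ + _) _ => notypeclasses refine (der_add _ _)
 | |- is_derive _ _ (fun u => - _) _ => notypeclasses refine (der_opp _)
 | |- is_derive _ _ (fun u => _ * _) _ => notypeclasses refine (der_mul _ _)
 | |- is_derive _ _ (fun u => _ ^+ 2) _ => notypeclasses refine (der_sqr _)
 | |- is_derive _ _ (fun u => _^-1) _ => notypeclasses refine (der_inv _ _)
 | |- is_derive _ _ (fun u => expR _) _ => notypeclasses refine (der_exp _)
 | |- is_derive _ _ (fun u => ln _) _ => notypeclasses refine (der_ln _ _)
 | |- is_derive _ _ expR _ => exact: is_derive_expR
 | |- is_derive _ _ -%R _ => exact: is_deriveNid
 | |- is_derive _ _ GRing.inv _ =>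
     notypeclasses refine (der_inv (f := fun u => u) _ (der_id _))
 | |- is_derive _ _ (@ln _) _ =>
     notypeclasses refine (der_ln (f := fun u => u) _ (der_id _))
 | |- is_derive _ _ ( *%R ?c) _ =>
     notypeclasses refine (der_mul (f := fun=> c) (der_cst c _) (der_id _))
 | |- is_derive _ _ (+%R ?c) _ =>
     notypeclasses refine (der_add (f := fun=> c) (der_cst c _) (der_id _))
 end.
Ltac der := notypeclasses refine (der_eq _ _); [repeat der_step | cbv beta].

Section sign_changes.
Context {R : realType}.
Implicit Types (f g : R -> R).

Lemma mean_value f g (s t : R) : s < t ->
  (forall x : R, s <= x <= t -> is_derive x 1 f (g x)) ->
  exists2 c, s < c < t & f t - f s = g c * (t - s).
Proof.
move=> st dfg.
have [||c + ->] := @MVT _ f g s t st.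
- by move=> x; rewrite in_itv/= => /andP[sx xt]; apply: dfg; rewrite !ltW.
- apply: derivable_within_continuous => x; rewrite in_itv/= => xst.
  by have [] := dfg x xst.
- by rewrite in_itv/=; exists c.
Qed.

Lemma derivative_ge0_nondecreasing f g (s t : R) : s <= t ->
  (forall x : R, s <= x <= t -> is_derive x 1 f (g x)) ->
  (forall x : R, s < x < t -> 0 <= g x) -> f s <= f t.
Proof.
rewrite le_eqVlt => /predU1P[-> //|st] dfg g0.
have [c /g0 gc0 E] := mean_value st dfg.
by rewrite -subr_ge0 E mulr_ge0// subr_ge0 ltW.
Qed.

Lemma derivative_gt0_increasing f g (s t : R) : s < t ->
  (forall x : R, s <= x <= t -> is_derive x 1 f (g x)) ->
  (forall x : R, s < x < t -> 0 < g x) -> f s < f t.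
Proof.
move=> st dfg g0.
have [c /g0 gc0 E] := mean_value st dfg.
by rewrite -subr_gt0 E mulr_gt0// subr_gt0.
Qed.

(** On the open half-line, [f] is negative, then possibly zero at one point,
    then positive; either phase may be empty. *)
Definition upcrossing f := forall s t : R, 0 < s -> s < t -> 0 <= f s -> 0 < f t.

(** Where the primitive is nonnegative at [s > 0], its mean slope between 0
    and [s] is nonnegative, so that the derivative has become positive by [s]. *)
Lemma upcrossing_primitive f g :
  (forall x : R, 0 <= x -> is_derive x 1 f (g x)) -> f 0 = 0 ->
  upcrossing g -> upcrossing f.
Proof.
move=> dfg f0 upg s t s0 st fs0.
have [|c /andP[c0 cs]] := mean_value s0 (f := f) (g := g).
  by move=> x /andP[x0 _]; exact: dfg.
rewrite f0 !subr0 => fsE.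
have gc0 : 0 <= g c by rewrite -(pmulr_lge0 _ s0) -fsE.
apply: (le_lt_trans fs0).
apply: (derivative_gt0_increasing st (g := g)) => [x /andP[sx _]|x /andP[sx _]].
- by apply: dfg; rewrite (le_trans _ sx)// ltW.
- by apply: (upg c) => //; rewrite (lt_trans cs).
Qed.

Lemma upcrossing_mul f g :
  (forall x : R, 0 < x -> 0 < g x) -> upcrossing f -> upcrossing (fun x => g x * f x).
Proof.
move=> g0 upf s t s0 st; rewrite pmulr_rge0 ?g0// => /(upf _ _ s0 st) ft.
by rewrite mulr_gt0// g0// (lt_trans s0).
Qed.

Lemma eq_upcrossing f g : (forall x : R, 0 < x -> f x = g x) ->
  upcrossing f -> upcrossing g.
Proof.
move=> fg upf s t s0 st; rewrite -fg// => /(upf _ _ s0 st).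
by rewrite fg// (lt_trans s0).
Qed.

Lemma increasing_upcrossing f :
  (forall s t : R, 0 < s -> s < t -> f s < f t) -> upcrossing f.
Proof. by move=> fi s t s0 /(fi _ _ s0) fst /le_lt_trans; exact. Qed.

(** The threshold is the supremum of the points where [f] is negative. *)
Lemma upcrossing_threshold f (t1 : R) : upcrossing f -> 0 < t1 -> 0 <= f t1 ->
  exists2 t0, 0 <= t0 &
    (forall t : R, 0 < t -> t < t0 -> f t < 0) /\ (forall t : R, t0 < t -> 0 < f t).
Proof.
move=> upf t10 ft1.
pose N := [set t : R | t = 0 \/ (0 < t /\ f t < 0)].
have Nt1 : ubound N t1.
  move=> t [->|[t0 ft]]; first exact: ltW.
  rewrite leNgt; apply/negP => t1t.
  by have := upf _ _ t10 t1t ft1; rewrite ltNge ltW.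
have hsN : has_sup N by split; [exists 0; left|exists t1].
have N0 : 0 <= sup N by apply: (ub_le_sup hsN.2); left.
exists (sup N) => //; split => t.
- move=> t0 tN.
  have [e Ne] := sup_adherent (eps := sup N - t) ltac:(by rewrite subr_gt0) hsN.
  rewrite subKr => te; case: Ne => [e0|[e0 fe]].
    by move: te; rewrite e0 ltNge ltW.
  rewrite ltNge; apply/negP => ft.
  by have := upf _ _ t0 te ft; rewrite ltNge ltW.
- move=> Nt; pose m := (sup N + t) / 2.
  have Nm : sup N < m by rewrite /m; lra.
  have mt : m < t by rewrite /m; lra.
  have m0 : 0 < m by exact: le_lt_trans N0 Nm.
  apply: (upf m) => //; rewrite leNgt; apply/negP => fm.
  have : m <= sup N by apply: (ub_le_sup hsN.2); right.
  by rewrite leNgt Nm.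
Qed.

End sign_changes.

(** * Inequalities between elementary functions *)

Section elementary_inequalities.
Context {R : realType}.
Implicit Types (t a y : R).

(** This function is convex on the half-line and vanishes at 0. *)
Lemma upcrossing_sinh_linear y a : 0 < y ->
  upcrossing (fun t : R => y * (expR t - expR (- t)) - a * t).
Proof.
move=> y0.
apply: (upcrossing_primitive (g := fun t => y * (expR t + expR (- t)) - a)).
- by move=> x _; der; ring.
- by rewrite oppr0 subrr !mulr0 subrr.
- apply: increasing_upcrossing => s t s0 st; rewrite ltrD2r ltr_pM2l//.
  apply: (@derivative_gt0_increasing _ (fun t => expR t + expR (- t))
    (fun t => expR t - expR (- t))) => //.
    by move=> x _; der; ring.
  by move=> x /andP[sx _]; rewrite subr_gt0 ltr_expR; lra.
Qed.

(** The numerator in the comparison of the two gap derivatives, below; it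
    vanishes at 0 together with its first three derivatives. *)
Lemma gap_numerator_ge0 t : 0 <= t ->
  0 <= (t - 4) * expR t + 2 * t ^+ 2 + 8 - (t + 4) * expR (- t).
Proof.
move=> t0.
pose f0 (t : R) := (t - 4) * expR t + 2 * t ^+ 2 + 8 - (t + 4) * expR (- t).
pose f1 (t : R) := (t - 3) * expR t + 4 * t + (t + 3) * expR (- t).
pose f2 (t : R) := (t - 2) * expR t + 4 - (t + 2) * expR (- t).
pose f3 (t : R) := (t - 1) * expR t + (t + 1) * expR (- t).
have nneg (f g : R -> R) : (forall x : R, is_derive x 1 f (g x)) -> f 0 = 0 ->
    (forall x : R, 0 <= x -> 0 <= g x) -> forall x, 0 <= x -> 0 <= f x.
  move=> dfg f00 g0 x x0; rewrite -f00.
  apply: (derivative_ge0_nondecreasing x0 (g := g)) => // z /andP[z0 _].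
  by apply: g0; exact: ltW.
apply: (nneg f0 f1) t0.
- by move=> x; rewrite /f0 /f1; der; ring.
- by rewrite /f0 oppr0 expR0; ring.
apply: (nneg f1 f2).
- by move=> x; rewrite /f1 /f2; der; ring.
- by rewrite /f1 oppr0 expR0; ring.
apply: (nneg f2 f3).
- by move=> x; rewrite /f2 /f3; der; ring.
- by rewrite /f2 oppr0 expR0; ring.
apply: (nneg f3 (fun t => t * (expR t - expR (- t)))).
- by move=> x; rewrite /f3; der; ring.
- by rewrite /f3 oppr0 expR0; ring.
by move=> x x0; rewrite mulr_ge0// subr_ge0 ler_expR; lra.
Qed.

Lemma ln2_lt1 : ln 2 < 1 :> R.
Proof.
by rewrite -ltr_expR lnK ?posrE//; have := @expR_gt1Dx R 1 (oner_neq0 _); lra.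
Qed.

(** Expanded, this is an exponential polynomial, treated as in the proof of
    Descartes' rule of signs: two derivatives remove the terms [1 - t];
    multiplication by [expR (c * t)] makes the contribution of
    [(1 + t) * expR (- (c * t))] a polynomial of degree 1, which two more
    derivatives remove. The result is positive, so that the function before
    the last derivative increases; the primitives taken from there vanish at
    0. *)
Lemma upcrossing_exp_poly (c : R) : c < 1 ->
  upcrossing (fun t : R =>
    expR ((1 - c) * t) * (1 - (1 + t) * expR (- t)) - (t - 1 + expR (- t))).
Proof.
move=> c1; pose e := 1 - c.
pose h1 (t : R) := e ^+ 2 * expR t + e * expR (- (e * t)) - c ^+ 2.
pose h0 (t : R) :=
  e ^+ 2 * expR t - expR (- (e * t)) - c ^+ 2 * t - c ^+ 2 + 2 * c.
pose g1 (t : R) :=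
  e * expR (e * t) - 1 + expR (- t) - (1 - c - c * t) * expR (- (c * t)).
pose g0 (t : R) :=
  expR (e * t) - t + 1 - expR (- t) - (1 + t) * expR (- (c * t)).
have uph1 : upcrossing h1.
  apply: increasing_upcrossing => s t s0 st.
  apply: (@derivative_gt0_increasing _ h1
    (fun t => e ^+ 2 * (expR t - expR (- (e * t))))) => //.
    by move=> x _; rewrite /h1; der; ring.
  move=> x /andP[sx _]; rewrite mulr_gt0 ?exprn_gt0//; first by rewrite /e; lra.
  by rewrite subr_gt0 ltr_expR /e; nra.
have uph0 : upcrossing h0.
  apply: upcrossing_primitive uph1; first by move=> x _; rewrite /h0 /h1; der; ring.
  by rewrite /h0 !mulr0 oppr0 expR0 /e; ring.
have upg1 : upcrossing g1.
  apply: (@upcrossing_primitive _ _ (fun t => expR (- (c * t)) * h0 t)).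
  - move=> x _; rewrite /g1; der.
    have -> : expR (e * x) = expR (- (c * x)) * expR x.
      by rewrite -expRD /e; congr expR; ring.
    have -> : expR (- x) = expR (- (c * x)) * expR (- (e * x)).
      by rewrite -expRD /e; congr expR; ring.
    by rewrite /h0; ring.
  - by rewrite /g1 !mulr0 oppr0 expR0 /e; ring.
  - by apply: upcrossing_mul => // x _; exact: expR_gt0.
apply: (@eq_upcrossing _ g0).
  move=> x _; rewrite /g0 -/e mulrBr mulr1 mulrCA -expRD.
  have -> : e * x - x = - (c * x) by rewrite /e; ring.
  ring.
apply: upcrossing_primitive upg1.
  by move=> x _; rewrite /g0 /g1; der; ring.
by rewrite /g0 !mulr0 oppr0 expR0; ring.
Qed.

End elementary_inequalities.

(** * Integration on the half-line *)

Section half_line.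
Context {R : realType}.
Notation mu := (@lebesgue_measure R).
Notation halfline := `](0 : R), +oo[%classic.
Implicit Types (f g F G : R -> R) (D J : set R).

Lemma integral_ge0_derivative F f (l : R) :
  (forall x : R, is_derive x 1 F (f x)) -> continuous f ->
  (forall x : R, 0 <= x -> 0 <= f x) -> F x @[x --> +oo] --> l ->
  (\int[mu]_(x in halfline) (f x)%:E = (l - F 0)%:E)%E.
Proof.
move=> dF cf f0 Fl.
rewrite integral_itv_obnd_cbnd; last first.
  by apply/measurable_EFinP/measurable_funTS; exact: continuous_measurable_fun.
rewrite (ge0_continuous_FTC2y (F := F) (l := l))//.
- by apply: continuous_subspaceT => x; exact: cf.
- by apply: cvg_at_right_filter; exact: der_continuous (dF 0).
- by move=> x _; exact: der_derive1 (dF x).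
Qed.

Lemma cvg_expRNZ (a : R) : 0 < a -> expR (- (a * t)) @[t --> +oo] --> (0 : R).
Proof.
move=> a0; apply: (@cvg_comp _ _ _ (fun t => a * t) (fun t => expR (- t)) _ +oo).
  by apply: gt0_cvgMry => //; exact: cvg_id.
exact: cvgr_expR.
Qed.

Lemma integrable_exp_decay f (C a : R) : 0 < a ->
  measurable_fun halfline f ->
  (forall t : R, 0 < t -> `|f t| <= C * expR (- (a * t))) ->
  mu.-integrable halfline (EFin \o f).
Proof.
move=> a0 mf fC.
have ce : continuous (fun t : R => expR (- (a * t))).
  by move=> t; apply: (@der_continuous _ _ _ (- a * expR (- (a * t)))); der; ring.
have ie : mu.-integrable halfline (EFin \o fun t => expR (- (a * t))).
  apply/integrableP; split.
    by apply/measurable_EFinP/measurable_funTS; exact: continuous_measurable_fun.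
  under eq_integral do rewrite /= ger0_norm ?expR_ge0//.
  have dE (x : R) : is_derive x 1 (fun t => - (expR (- (a * t)) / a)) (expR (- (a * x))).
    by der; field; rewrite gt_eqF.
  have lE : - (expR (- (a * t)) / a) @[t --> +oo] --> (0 : R).
    rewrite -oppr0; apply: cvgN; rewrite -(mul0r a^-1).
    by apply: cvgMl; exact: cvg_expRNZ.
  by rewrite (integral_ge0_derivative dE ce _ lE) ?ltry// => x _; exact: expR_ge0.
have mh : measurable (halfline : set (measurableTypeR R)) by exact: measurable_itv.
have := integrableZl mh C ie.
apply: le_integrable => //=; first exact/measurable_EFinP.
move=> t; rewrite in_itv/= andbT => t0; rewrite lee_fin.
by rewrite (le_trans (fC _ t0))// ler_norm.
Qed.

(** If the integral vanished, then so would [f] almost everywhere, whereas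
    the interval from [a] to [b] has positive length. *)
Lemma integral_gt0 D (f : R -> R) (a b : R) : measurable D -> a < b ->
  `]a, b[ `<=` D -> measurable_fun D f -> (forall t : R, D t -> 0 <= f t) ->
  (forall t : R, a < t < b -> 0 < f t) -> (0 < \int[mu]_(t in D) (f t)%:E)%E.
Proof.
move=> mD ab abD mf f0 fpos.
rewrite lt0e integral_ge0 ?andbT; last by move=> t /f0; rewrite lee_fin.
apply/eqP => I0.
have mEf : measurable_fun D (EFin \o f) by exact/measurable_EFinP.
have /(ae_eq_integral_abs mu mD mEf) f_ae0 :
    (\int[mu]_(x in D) `|(EFin \o f) x| = 0)%E.
  rewrite -I0; apply: eq_integral => t; rewrite inE => Dt.
  by rewrite /= ger0_norm// f0.
have abN : mu.-negligible `]a, b[.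
  apply: negligibleS f_ae0 => t /= abt; apply/not_implyP.
  split; first exact: abD.
  by move=> [] ft0; move: (fpos t); rewrite ft0 ltxx => /(_ _)/negP; apply.
have mab : measurable (`]a, b[%classic : set (measurableTypeR R)) by exact: measurable_itv.
have := measure_negligible mab abN.
rewrite [X in X = _](_ : _ = mu `]a, b[)//.
rewrite lebesgue_measure_itv/= lte_fin ab -EFinD => -[] /eqP.
by rewrite subr_eq0 gt_eqF.
Qed.

(** The segments from [1 / n] to [n] exhaust the half-line and their images
    exhaust [J], so that the substitution rule for segments passes to the
    limit by monotone convergence. *)
Lemma substitution_increasing J F f G : is_interval J ->
  (forall t : R, 0 < t -> is_derive t 1 F (f t)) ->
  (forall t : R, 0 < t -> 0 < f t) ->
  (forall t : R, 0 < t -> {for t, continuous f}) ->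
  (forall t : R, 0 < t -> J (F t)) ->
  (forall y : R, J y -> exists s t, [/\ 0 < s, 0 < t, F s <= y & y <= F t]) ->
  (forall y : R, J y -> {for y, continuous G}) ->
  (forall y : R, J y -> 0 <= G y) ->
  (\int[mu]_(y in J) (G y)%:E = \int[mu]_(t in halfline) (G (F t) * f t)%:E)%E.
Proof.
move=> itvJ dF f0 cf FJ Jex cG G0.
have Finc s t : 0 < s -> s < t -> F s < F t.
  move=> s0 st; apply: (@derivative_gt0_increasing _ _ f) => // x /andP[sx _].
    by apply: dF; exact: lt_le_trans sx.
  by apply: f0; exact: lt_trans sx.
have Fle s t : 0 < s -> s <= t -> F s <= F t.
  by move=> s0; rewrite le_eqVlt => /predU1P[->//|/(Finc _ _ s0)/ltW].
pose a n : R := n.+1%:R^-1; pose b n : R := n.+1%:R.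
have a0 n : 0 < a n by rewrite /a.
have b0 n : 0 < b n by rewrite /b.
have ab n : a n <= b n.
  by rewrite /a /b (@le_trans _ _ 1)// ?invf_le1 ?ler1n.
have an m n : (m <= n)%N -> a n <= a m by move=> mn; rewrite lef_pV2 ?posrE// ler_nat.
have bn m n : (m <= n)%N -> b m <= b n by move=> mn; rewrite ler_nat.
have ex_a s : 0 < s -> exists n, a n <= s.
  move=> s0; exists (Num.truncn s^-1); rewrite /a invf_ple ?posrE//.
  by rewrite ltW// truncnS_gt.
have ex_b (t : R) : exists n, t <= b n.
  by exists (Num.truncn t); rewrite ltW// truncnS_gt.
have Idef : halfline = \bigcup_n `[a n, b n]%classic.
  apply/seteqP; split => t /=.
    rewrite in_itv/= andbT => t0.
    have [m am] := ex_a _ t0; have [n bn'] := ex_b t.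
    exists (maxn m n) => //=; rewrite in_itv/= (le_trans (an _ _ (leq_maxl m n)))//=.
    by rewrite (le_trans bn')// bn// leq_maxr.
  by move=> [n _] /=; rewrite !in_itv/= andbT => /andP[+ _]; exact: lt_le_trans.
have Jdef : J = \bigcup_n `[F (a n), F (b n)]%classic.
  apply/seteqP; split => y /=.
    move=> /Jex[s [t [s0 t0 Fs Ft]]].
    have [m am] := ex_a _ s0; have [n bn'] := ex_b t.
    exists (maxn m n) => //=; rewrite in_itv/=; apply/andP; split.
      apply: le_trans Fs; apply: Fle => //.
      by apply: le_trans am; exact/an/leq_maxl.
    apply: (le_trans Ft); apply: Fle => //.
    by apply: (le_trans bn'); exact/bn/leq_maxr.
  move=> [n _] /=; rewrite in_itv/= => /andP[ay yb].
  by apply: (itvJ (F (a n)) (F (b n))); rewrite ?ay//; exact: FJ.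
have cF (t : R) : 0 < t -> {for t, continuous F}.
  by move=> t0; exact: der_continuous (dF _ t0).
have f'E (t : R) : 0 < t -> derive1 F t = f t by move=> t0; exact: der_derive1 (dF _ t0).
have cf' (t : R) : 0 < t -> {for t, continuous (derive1 F)}.
  move=> t0; rewrite /prop_for /continuous_at f'E//.
  apply: cvg_trans (cf _ t0); apply: near_eq_cvg.
  near=> z; rewrite f'E//; near: z; exact: lt_nbhsr.
have H n : (\int[mu]_(y in `[F (a n), F (b n)]) (G y)%:E =
            \int[mu]_(t in `[a n, b n]) (G (F t) * f t)%:E)%E.
  rewrite integration_by_substitution_increasing//.
  - apply: eq_integral => t; rewrite inE/= in_itv/= => /andP[at' _].
    by rewrite !fctE f'E//; exact: lt_le_trans at'.
  - move=> s t; rewrite !in_itv/= => /andP[as' _] _; apply: Finc.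
    exact: lt_le_trans as'.
  - move=> t; rewrite in_itv/= => /andP[at' _]; apply: cf'.
    exact: lt_trans at'.
  - by apply/cvg_ex; exists (derive1 F (a n)); apply: cvg_at_right_filter; exact: cf'.
  - by apply/cvg_ex; exists (derive1 F (b n)); apply: cvg_at_left_filter; exact: cf'.
  - split; [|by apply: cvg_at_right_filter; exact: cF|
             by apply: cvg_at_left_filter; exact: cF].
    move=> t; rewrite in_itv/= => /andP[at' _].
    by have [] := dF t (lt_trans (a0 n) at').
  - apply: continuous_in_subspaceT => y; rewrite inE => yI; apply: cG.
    by rewrite Jdef; exists n.
have ndI : nondecreasing_seq (fun n => `[a n, b n]%classic).
  move=> m n mn; rewrite subsetEset; apply: subset_itv; rewrite bnd_simp.
    exact: an.
  exact: bn.
have ndJ : nondecreasing_seq (fun n => `[F (a n), F (b n)]%classic).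
  move=> m n mn; rewrite subsetEset; apply: subset_itv; rewrite bnd_simp; apply: Fle => //.
    exact: an.
  exact: bn.
have mG n : measurable_fun `[F (a n), F (b n)] G.
  apply: subspace_continuous_measurable_fun => //.
  apply: continuous_in_subspaceT => y; rewrite inE => yI; apply: cG.
  by rewrite Jdef; exists n.
have mGF n : measurable_fun `[a n, b n] (fun t => G (F t) * f t).
  apply: subspace_continuous_measurable_fun => //.
  apply: continuous_in_subspaceT => t; rewrite inE/= in_itv/= => /andP[at' _].
  have t0 : 0 < t by exact: lt_le_trans at'.
  apply: cvgM; last exact: cf.
  apply: (@continuous_comp _ _ _ F G); first exact: cF.
  by apply: cG; exact: FJ.
have lJ : (\int[mu]_(y in `[F (a n), F (b n)]) (G y)%:E @[n --> \oo] -->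
    \int[mu]_(y in \bigcup_n `[F (a n), F (b n)]%classic) (G y)%:E)%E.
  pose IJ n : set (measurableTypeR R) := `[F (a n), F (b n)]%classic.
  apply: (@ge0_nondecreasing_set_cvg_integral _ _ _ IJ (EFin \o G)) => //.
    by move=> n; exact: measurable_itv.
    by move=> n; apply/measurable_EFinP; exact: mG.
  by move=> n y /= yI; rewrite lee_fin; apply: G0; rewrite Jdef; exists n.
have lI : (\int[mu]_(t in `[a n, b n]) (G (F t) * f t)%:E @[n --> \oo] -->
    \int[mu]_(t in \bigcup_n `[a n, b n]%classic) (G (F t) * f t)%:E)%E.
  pose II n : set (measurableTypeR R) := `[a n, b n]%classic.
  apply: (@ge0_nondecreasing_set_cvg_integral _ _ _ II
    (EFin \o (fun t => G (F t) * f t))) => //.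
    by move=> n; exact: measurable_itv.
    by move=> n; apply/measurable_EFinP; exact: mGF.
  move=> n t; rewrite /II/= in_itv/= => /andP[at' _].
  have t0 : 0 < t by exact: lt_le_trans at'.
  by rewrite lee_fin mulr_ge0 ?G0//; [exact: FJ|exact/ltW/f0].
rewrite [in RHS]Idef [in LHS]Jdef; apply: (cvg_unique _ lJ) => //=.
by under eq_fun do rewrite H.
Unshelve. all: by end_near. Qed.

End half_line.

(** * Comparison of integrals by a single sign change *)

Section crossing.
Context {R : realType}.
Notation mu := (@lebesgue_measure R).
Notation halfline := `](0 : R), +oo[%classic.
Implicit Types (f g D w : R -> R).

Lemma measurable_halfline : measurable (halfline : set (measurableTypeR R)).
Proof. exact: measurable_itv. Qed.

Lemma integrable_measurable (A : set R) f :
  mu.-integrable A (EFin \o f) -> measurable_fun A f.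
Proof. by move=> /measurable_int/measurable_EFinP. Qed.

Lemma Rintegral_gt0 f (a : R) : mu.-integrable halfline (EFin \o f) -> 0 <= a ->
  (forall t : R, 0 < t -> 0 <= f t) -> (forall t : R, a < t -> 0 < f t) ->
  0 < \int[mu]_(t in halfline) f t.
Proof.
move=> intf a0 f0 fa; rewrite /Rintegral fine_gt0//; apply/andP; split; last first.
  by rewrite -ge0_fin_numE ?integral_ge0//; [exact: integrable_fin_num|
    move=> t /=; rewrite in_itv/= andbT lee_fin; exact: f0].
apply: (@integral_gt0 _ _ _ a (a + 1)).
- exact: measurable_halfline.
- by rewrite ltrDl.
- move=> t /=; rewrite !in_itv/= andbT => /andP[at' _]; exact: le_lt_trans at'.
- exact: integrable_measurable.
- by move=> t /=; rewrite in_itv/= andbT; exact: f0.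
- by move=> t /andP[+ _]; exact: fa.
Qed.

Lemma Rintegral_comb f g (k : R) : mu.-integrable halfline (EFin \o f) ->
  mu.-integrable halfline (EFin \o g) ->
  mu.-integrable halfline (EFin \o (fun t => g t - k * f t)) /\
  \int[mu]_(t in halfline) (g t - k * f t) =
  \int[mu]_(t in halfline) g t - k * \int[mu]_(t in halfline) f t.
Proof.
move=> intf intg.
have intkf : mu.-integrable halfline (EFin \o (fun t => k * f t)).
  by have := integrableZl measurable_halfline k intf.
split; first by have := integrableB measurable_halfline intg intkf.
by rewrite RintegralB// RintegralZl.
Qed.

(** A weight that grows relative to another one favours the region where an
    upcrossing function is positive: subtracting the multiple of the old
    weight that agrees with the new one at the sign change leaves a positive
    integrand. *)
Lemma crossing_integral D w1 w2 rho : upcrossing D ->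
  (forall t : R, 0 < t -> w2 t = rho t * w1 t) -> (forall t : R, 0 < t -> 0 < w1 t) ->
  0 <= rho 0 -> (forall s t : R, 0 <= s -> s < t -> rho s < rho t) ->
  mu.-integrable halfline (EFin \o (fun t => w1 t * D t)) ->
  mu.-integrable halfline (EFin \o (fun t => w2 t * D t)) ->
  0 <= \int[mu]_(t in halfline) (w1 t * D t) ->
  0 < \int[mu]_(t in halfline) (w2 t * D t).
Proof.
move=> upD w2E w10 rho0 rhoi int1 int2 I1.
have [t1 t10 Dt1] : exists2 t1, 0 < t1 & 0 <= D t1.
  apply: contrapT => noD.
  have Dneg t : 0 < t -> D t < 0.
    by move=> t0; rewrite ltNge; apply/negP => Dt; apply: noD; exists t.
  have [intN E] := Rintegral_comb 2 int1 int1.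
  have : 0 < \int[mu]_(t in halfline) (w1 t * D t - 2 * (w1 t * D t)).
    have H t : w1 t * D t - 2 * (w1 t * D t) = w1 t * - D t by ring.
    apply: (Rintegral_gt0 (a := 0)) => // t t0; rewrite H.
      by rewrite mulr_ge0 ?oppr_ge0 ?ltW ?w10// Dneg.
    by rewrite mulr_gt0 ?w10// oppr_gt0 Dneg.
  by rewrite E; lra.
have [t0 t00 [Dneg Dpos]] := upcrossing_threshold upD t10 Dt1.
have [intc E] := Rintegral_comb (rho t0) int1 int2.
have : 0 < \int[mu]_(t in halfline) (w2 t * D t - rho t0 * (w1 t * D t)).
  have H t : 0 < t -> w2 t * D t - rho t0 * (w1 t * D t) =
      w1 t * ((rho t - rho t0) * D t).
    by move=> /w2E->; ring.
  apply: (Rintegral_gt0 (a := t0)) => // t tt; rewrite H//; last exact: le_lt_trans tt.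
    apply: mulr_ge0; first by rewrite ltW// w10.
    case: (ltgtP t t0) => [tt0|t0t|->]; last by rewrite subrr mul0r.
      rewrite nmulr_rge0 ?subr_lt0; first by rewrite ltW// Dneg.
      by apply: rhoi => //; exact: ltW.
    by rewrite mulr_ge0 ?subr_ge0 ?ltW// ?Dpos// rhoi.
  rewrite mulr_gt0 ?w10//; first exact: le_lt_trans tt.
  by rewrite mulr_gt0 ?subr_gt0 ?rhoi// Dpos.
rewrite E subr_gt0; apply: le_lt_trans; apply: mulr_ge0 => //.
by move: t00; rewrite le_eqVlt => /predU1P[<-//|/(rhoi _ _ (lexx _))/ltW]; exact: le_trans.
Qed.

End crossing.

(** * The symmetric Gaussian weight *)

Section gauss_weight.
Context {R : realType}.
Notation mu := (@lebesgue_measure R).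
Implicit Types (z b : R).

(** Unnormalized: [gauss_fun x] is [expR (- x ^+ 2)]. *)
Definition gauss_cdf z : R := \int[mu]_(q in `]-oo, z]) gauss_fun q.

Definition gauss_weight z : R := gauss_cdf z - gauss_cdf (- z).

Lemma integrable_gauss_Iic z : mu.-integrable `]-oo, z] (EFin \o gauss_fun).
Proof. by apply: integrableS integrableT_gauss => //. Qed.

Lemma der_gauss_cdf z : is_derive z 1 gauss_cdf (gauss_fun z).
Proof.
have [] := @continuous_FTC1 R gauss_fun -oo%O z (z + 1) _ _ _ _.
- by rewrite ltrDl.
- exact: integrable_gauss_Iic.
- exact: ltNyr.
- exact: continuous_gauss_fun.
- by move=> dz <-; rewrite derive1E; apply: DeriveDef.
Qed.

Lemma der_gauss_weight z : is_derive z 1 gauss_weight (2 * gauss_fun z).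
Proof.
have dN : is_derive z 1 (fun u => gauss_cdf (- u)) (- gauss_fun z).
  have := is_derive1_comp (der_gauss_cdf (- z)) (is_deriveNid z 1).
  by rewrite [in X in X -> _]/gauss_fun sqrrN mulrN1.
have := der_add (der_gauss_cdf z) (der_opp dN).
by rewrite opprK mulr_natl mulr2n.
Qed.

Lemma gauss_fun_gt0 z : 0 < gauss_fun z. Proof. exact: expR_gt0. Qed.

Lemma der_gauss_fun z : is_derive z 1 gauss_fun (- (2 * z * gauss_fun z)).
Proof. by rewrite /gauss_fun; der; ring. Qed.

Lemma gauss_weight0 : gauss_weight 0 = 0.
Proof. by rewrite /gauss_weight oppr0 subrr. Qed.

Lemma gauss_weight_increasing z b : z < b -> gauss_weight z < gauss_weight b.
Proof.
move=> zb; apply: (derivative_gt0_increasing zb) => x _.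
  exact: der_gauss_weight.
by rewrite mulr_gt0// gauss_fun_gt0.
Qed.

Lemma gauss_weight_gt0 z : 0 < z -> 0 < gauss_weight z.
Proof. by move=> z0; rewrite -gauss_weight0 gauss_weight_increasing. Qed.

Lemma gauss_weight_le z : 0 <= z -> gauss_weight z <= 2 * z.
Proof.
move=> z0; rewrite -subr_ge0.
have -> : 0 = 2 * 0 - gauss_weight 0 by rewrite gauss_weight0; ring.
apply: (@derivative_ge0_nondecreasing _ (fun z => 2 * z - gauss_weight z)
  (fun z => 2 - 2 * gauss_fun z)) => // [x _|x _].
  have := der_gauss_weight x => dx.
  notypeclasses refine (der_eq (der_add (der_mul (der_cst 2 x) (der_id x)) (der_opp dx)) _).
  ring.
by have := gauss_fun_le1 x; lra.
Qed.

(** The Gaussian density decreases between 0 and [z]; with [gauss_weight_le] this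
    makes [gauss_weight z] comparable to [2 * z] for small [z]. *)
Lemma gauss_weight_ge z : 0 <= z -> 2 * z * gauss_fun z <= gauss_weight z.
Proof.
move=> z0; rewrite -subr_ge0.
have -> : 0 = gauss_weight 0 - 2 * 0 * gauss_fun 0 by rewrite gauss_weight0; ring.
apply: (@derivative_ge0_nondecreasing _ (fun z => gauss_weight z - 2 * z * gauss_fun z)
  (fun z => 4 * z ^+ 2 * gauss_fun z)) => // [x _|x _].
  have := der_gauss_weight x => dx; have := der_gauss_fun x => dg.
  notypeclasses refine (der_eq (der_add dx (der_opp (der_mul
    (der_mul (der_cst 2 x) (der_id x)) dg))) _).
  cbv beta; ring.
by rewrite mulr_ge0 ?gauss_fun_ge0// mulr_ge0// sqr_ge0.
Qed.

Lemma gauss_weight_lt z : 0 < z -> 2 * z * gauss_fun z < gauss_weight z.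
Proof.
move=> z0; rewrite -subr_gt0.
have -> : 0 = gauss_weight 0 - 2 * 0 * gauss_fun 0 by rewrite gauss_weight0; ring.
apply: (@derivative_gt0_increasing _ (fun z => gauss_weight z - 2 * z * gauss_fun z)
  (fun z => 4 * z ^+ 2 * gauss_fun z)) => // [x _|x /andP[x0 _]].
  have := der_gauss_weight x => dx; have := der_gauss_fun x => dg.
  notypeclasses refine (der_eq (der_add dx (der_opp (der_mul
    (der_mul (der_cst 2 x) (der_id x)) dg))) _).
  cbv beta; ring.
by rewrite mulr_gt0 ?gauss_fun_gt0// mulr_gt0// exprn_gt0.
Qed.

Lemma gauss_cdf_bounded : exists2 M, 0 < M & forall z, 0 <= gauss_cdf z <= M.
Proof.
exists (\int[mu]_(q in [set: R]) gauss_fun q + 1) => [|z].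
  by rewrite ltr_wpDl// Rintegral_ge0// => q _; exact: gauss_fun_ge0.
rewrite Rintegral_ge0/=; last by move=> q _; exact: gauss_fun_ge0.
rewrite ler_wpDr// fine_le//.
- by apply: integrable_fin_num => //; exact: integrable_gauss_Iic.
- by apply: integrable_fin_num => //; exact: integrableT_gauss.
apply: ge0_subset_integral => //.
  by apply/measurable_EFinP; exact: measurable_gauss_fun.
by move=> x _; rewrite lee_fin gauss_fun_ge0.
Qed.

Lemma gauss_weight_bounded : exists M, forall z, gauss_weight z <= M.
Proof.
have [M _ HM] := gauss_cdf_bounded; exists M => z; rewrite /gauss_weight.
by have /andP[_ zM] := HM z; have /andP[Nz0 _] := HM (- z); lra.
Qed.

(** The last hypothesis is positivity of the numerator of the derivative; at
    0 the quotient is 0, the value of a division by 0, which lies below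
    every other value. *)
Lemma quotient_increasing (f g f' g' : R -> R) :
  (forall x : R, 0 <= x -> is_derive x 1 f (f' x)) ->
  (forall x : R, 0 <= x -> is_derive x 1 g (g' x)) ->
  g 0 = 0 -> (forall x : R, 0 < x -> 0 < f x) -> (forall x : R, 0 < x -> 0 < g x) ->
  (forall x : R, 0 < x -> 0 < f' x * g x - f x * g' x) ->
  forall s t : R, 0 <= s -> s < t -> f s / g s < f t / g t.
Proof.
move=> df dg g0 fp gp np s t; rewrite le_eqVlt => /predU1P[<-|s0] st.
  by rewrite g0 invr0 mulr0 divr_gt0 ?fp ?gp.
apply: (@derivative_gt0_increasing _ (fun x => f x / g x)
  (fun x => (f' x * g x - f x * g' x) / g x ^+ 2)) => // x /andP[sx _].
  have x0 : 0 < x by exact: lt_le_trans sx.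
  have gx : g x != 0 by rewrite gt_eqF// gp.
  notypeclasses refine (der_eq (der_mul (df x (ltW x0)) (der_inv gx (dg x (ltW x0)))) _).
  by field.
have x0 : 0 < x by exact: lt_trans sx.
by rewrite divr_gt0 ?np// exprn_gt0// gp.
Qed.

(** The derivative of the numerator divided by that of the denominator is
    [b * expR ((1 - b ^+ 2) * x ^+ 2)], which increases. *)
Lemma gauss_weight_ratio_increasing b : 0 < b -> b < 1 ->
  forall s t : R, 0 <= s -> s < t ->
  gauss_weight (b * s) / gauss_weight s < gauss_weight (b * t) / gauss_weight t.
Proof.
move=> b0 b1; have db (x : R) :
    is_derive x 1 (fun z => gauss_weight (b * z)) (2 * b * gauss_fun (b * x)).
  have dbx : is_derive x 1 (fun z => b * z) b by der; ring.
  apply: (der_eq (is_derive1_comp (der_gauss_weight (b * x)) dbx)); ring.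
apply: (@quotient_increasing (fun z => gauss_weight (b * z)) gauss_weight
  (fun z => 2 * b * gauss_fun (b * z)) (fun z => 2 * gauss_fun z)).
- by move=> x _; exact: der_gauss_weight.
- exact: gauss_weight0.
- by move=> x x0; rewrite gauss_weight_gt0// mulr_gt0.
- by move=> x x0; rewrite gauss_weight_gt0.
move=> x x0.
(* after division by the Gaussian factor of the denominator the numerator
   vanishes at 0 and has a positive derivative *)
pose m (z : R) := expR ((1 - b ^+ 2) * z ^+ 2).
have mE z : gauss_fun (b * z) = m z * gauss_fun z.
  by rewrite /m /gauss_fun -expRD; congr expR; ring.
pose n (z : R) := b * m z * gauss_weight z - gauss_weight (b * z).
have -> : 2 * b * gauss_fun (b * x) * gauss_weight x -
    gauss_weight (b * x) * (2 * gauss_fun x) = 2 * gauss_fun x * n x.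
  by rewrite mE /n; ring.
rewrite mulr_gt0 ?mulr_gt0 ?gauss_fun_gt0//.
have n0 : n 0 = 0 by rewrite /n mulr0 gauss_weight0; ring.
rewrite -n0; pose n' (z : R) := b * (2 * (1 - b ^+ 2) * z) * m z * gauss_weight z.
have dn (z : R) : is_derive z 1 n (n' z).
  have dm : is_derive z 1 m (2 * (1 - b ^+ 2) * z * m z) by rewrite /m; der; ring.
  notypeclasses refine (der_eq (der_add (der_mul (der_mul (der_cst b z) dm)
    (der_gauss_weight z)) (der_opp (db z))) _).
  by rewrite mE /n'; cbv beta; ring.
apply: (derivative_gt0_increasing x0 (fun z _ => dn z)) => z /andP[z0 _].
have b2 : 0 < 1 - b ^+ 2 by nra.
rewrite /n' mulr_gt0 ?gauss_weight_gt0// mulr_gt0 ?expR_gt0// mulr_gt0//.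
by rewrite mulr_gt0// mulr_gt0.
Qed.

Lemma id_gauss_weight_ratio_increasing (s t : R) : 0 <= s -> s < t ->
  s / gauss_weight s < t / gauss_weight t.
Proof.
apply: (@quotient_increasing id gauss_weight (fun=> 1) (fun z => 2 * gauss_fun z)).
- by move=> x _; exact: der_gauss_weight.
- exact: gauss_weight0.
- by [].
- by move=> x x0; exact: gauss_weight_gt0.
by move=> x /gauss_weight_lt; lra.
Qed.

End gauss_weight.

(** * The odd part of the log-gamma density *)

Section kernel.
Context {R : realType}.
Notation mu := (@lebesgue_measure R).
Notation halfline := `](0 : R), +oo[%classic.
Implicit Types (a y t : R) (w : R -> R).

(** Up to a constant, the density of [ln y - ln X] for a variable [X] with
    the gamma distribution of shape [a] and rate 1. *)
Definition kern a y t : R := expR (- (a * t) - y * expR (- t)).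

(** Compares the values [y * expR (- t)] and [y * expR t] of [X], placed
    symmetrically around [y] on the logarithmic scale. *)
Definition kern_diff a y t : R := kern a y t - kern a y (- t).

(** Twice the hyperbolic sine of half the argument. *)
Definition delta t : R := expR (t / 2) - expR (- (t / 2)).

Lemma kern_gt0 a y t : 0 < kern a y t. Proof. exact: expR_gt0. Qed.

Lemma kernN a y t : kern a y (- t) = expR (a * t - y * expR t).
Proof. by rewrite /kern mulrN !opprK. Qed.

Lemma der_kern a y t : is_derive t 1 (kern a y) ((y * expR (- t) - a) * kern a y t).
Proof. by rewrite /kern; der; ring. Qed.

Lemma der_kernN a y t :
  is_derive t 1 (fun u => kern a y (- u)) ((a - y * expR t) * kern a y (- t)).
Proof. by rewrite kernN /kern; der; rewrite !mulrN !opprK; ring. Qed.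

Lemma continuous_kern a y : continuous (kern a y).
Proof. by move=> t; exact: der_continuous (der_kern a y t). Qed.

Lemma continuous_kernN a y : continuous (fun t => kern a y (- t)).
Proof. by move=> t; exact: der_continuous (der_kernN a y t). Qed.

Lemma der_delta t : is_derive t 1 delta ((expR (t / 2) + expR (- (t / 2))) / 2).
Proof. by rewrite /delta; der; field. Qed.

Lemma delta0 : delta 0 = 0.
Proof. by rewrite /delta mul0r oppr0 subrr. Qed.

Lemma delta_increasing s t : s < t -> delta s < delta t.
Proof.
move=> st; apply: (derivative_gt0_increasing st (fun z _ => der_delta z)) => z _.
by rewrite divr_gt0// addr_gt0// expR_gt0.
Qed.

Lemma delta_gt0 t : 0 < t -> 0 < delta t.
Proof. by move=> t0; rewrite -delta0 delta_increasing. Qed.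

Lemma delta_ge0 t : 0 <= t -> 0 <= delta t.
Proof. by rewrite le_eqVlt => /predU1P[<-|/delta_gt0/ltW//]; rewrite delta0. Qed.

Lemma continuous_delta : continuous delta.
Proof. by move=> t; exact: der_continuous (der_delta t). Qed.

Lemma measurable_delta : measurable_fun halfline delta.
Proof.
by apply: measurable_funTS; exact: continuous_measurable_fun continuous_delta.
Qed.

Lemma delta_le t : delta t <= expR (t / 2).
Proof. by rewrite /delta gerBl expR_ge0. Qed.

(** Compare the exponents: their difference is the function of
    [upcrossing_sinh_linear], with [2 * a] for [a]. *)
Lemma upcrossing_kern_diff a y : 0 < y -> upcrossing (kern_diff a y).
Proof.
move=> y0 s t s0 st.
have /= up := @upcrossing_sinh_linear _ _ (2 * a) y0 s t s0 st.
rewrite /kern_diff subr_ge0 subr_gt0 !kernN /kern ler_expR ltr_expR => h.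
suff : 0 < y * (expR t - expR (- t)) - 2 * a * t by lra.
by apply: up; lra.
Qed.

Lemma kernN_decay a y : 0 < y ->
  exists2 C, 0 < C & forall t, 0 < t -> kern a y (- t) <= C * expR (- t).
Proof.
move=> y0; pose b := `|a| + 1; have b0 : 0 < b by rewrite /b ltr_wpDl.
pose k := ln (b / y); exists (expR (b * (k - 1))); first exact: expR_gt0.
move=> t t0; rewrite kernN -expRD ler_expR.
(* tangent line of the exponential at the point k *)
have H : b * (1 + (t - k)) <= y * expR t.
  have -> : y * expR t = b * expR (t - k).
    rewrite expRB /k lnK ?posrE ?divr_gt0//; field.
    by rewrite !gt_eqF.
  by rewrite ler_pM2l// expR_ge1Dx.
have : a * t <= `|a| * t by rewrite ler_pM2r// ler_norm.
by rewrite /b in H *; nra.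
Qed.

Lemma kern_decay a y t : 0 < y -> kern a y t <= expR (- (a * t)).
Proof. by move=> y0; rewrite ler_expR gerBl mulr_ge0// ?expR_ge0// ltW. Qed.

(** With constant weights ([b = 0]) this covers all shapes [a > 0]; the
    weight [delta] ([b = 1 / 2]) needs [a > 1 / 2]. *)
Lemma integrable_kern w (M b a y : R) : 0 < y -> b < a ->
  measurable_fun halfline w -> (forall t, 0 < t -> `|w t| <= M * expR (b * t)) ->
  mu.-integrable halfline (EFin \o (fun t => w t * kern a y t)).
Proof.
move=> y0 ba mw wM; apply: (@integrable_exp_decay _ _ M (a - b)).
- by rewrite subr_gt0.
- apply: measurable_funM => //; apply: measurable_funTS.
  exact: continuous_measurable_fun (@continuous_kern a y).
move=> t t0; rewrite normrM (ger0_norm (ltW (kern_gt0 _ _ _))).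
have -> : - ((a - b) * t) = b * t + - (a * t) by ring.
rewrite expRD mulrA ler_pM ?wM// ?kern_decay//; exact/ltW/kern_gt0.
Qed.

(** The double exponential in [kern a y (- t)] beats any exponential
    growth of the weight. *)
Lemma integrable_kernN w (M b a y : R) : 0 < y ->
  measurable_fun halfline w -> (forall t, 0 < t -> `|w t| <= M * expR (b * t)) ->
  mu.-integrable halfline (EFin \o (fun t => w t * kern a y (- t))).
Proof.
move=> y0 mw wM; have [C C0 HC] := kernN_decay (b + a) y0.
apply: (@integrable_exp_decay _ _ (M * C) 1) => //.
  apply: measurable_funM => //; apply: measurable_funTS.
  exact: continuous_measurable_fun (@continuous_kernN a y).
move=> t t0; rewrite normrM (ger0_norm (ltW (kern_gt0 _ _ _))) mul1r.
have M0 : 0 <= M.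
  by rewrite -(pmulr_lge0 M (expR_gt0 (b * t))); exact: le_trans (wM _ t0).
apply: (@le_trans _ _ (M * expR (b * t) * kern a y (- t))).
  by rewrite ler_wpM2r ?wM//; exact/ltW/kern_gt0.
rewrite -!mulrA ler_wpM2l//.
have -> : expR (b * t) * kern a y (- t) = kern (b + a) y (- t).
  by rewrite !kernN -expRD; congr expR; ring.
exact: HC.
Qed.

Lemma integrable_kern_diff w (M b a y : R) : 0 < y -> b < a ->
  measurable_fun halfline w -> (forall t, 0 < t -> `|w t| <= M * expR (b * t)) ->
  mu.-integrable halfline (EFin \o (fun t => w t * kern_diff a y t)).
Proof.
move=> y0 ba mw wM.
have := integrableB measurable_halfline (integrable_kern y0 ba mw wM)
  (integrable_kernN a y0 mw wM).
by apply: eq_integrable; [exact: measurable_halfline|move=> t _; rewrite /= -EFinB mulrBr].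
Qed.

Lemma Rintegral_kern_diff w (M b a y : R) : 0 < y -> b < a ->
  measurable_fun halfline w -> (forall t, 0 < t -> `|w t| <= M * expR (b * t)) ->
  \int[mu]_(t in halfline) (w t * kern_diff a y t) =
  \int[mu]_(t in halfline) (w t * kern a y t) -
  \int[mu]_(t in halfline) (w t * kern a y (- t)).
Proof.
move=> y0 ba mw wM; rewrite -RintegralB//.
- by apply: eq_Rintegral => t _; rewrite mulrBr.
- exact: integrable_kern wM.
- exact: integrable_kernN wM.
Qed.

Lemma measurable_gauss_weight_delta (l : R) :
  measurable_fun halfline (fun t => gauss_weight (l * delta t)).
Proof.
apply: measurable_funTS; apply: continuous_measurable_fun => t.
apply: (@continuous_comp _ _ _ (fun u => l * delta u) gauss_weight).
  exact: der_continuous (der_mul (der_cst l t) (der_delta t)).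
exact: der_continuous (der_gauss_weight _).
Qed.

Lemma gauss_weight_delta_bound (l : R) : 0 < l ->
  exists M, forall t, 0 < t -> `|gauss_weight (l * delta t)| <= M * expR (0 * t).
Proof.
move=> l0; have [M WM] := @gauss_weight_bounded R.
exists M => t t0; rewrite mul0r expR0 mulr1.
have ld : 0 < l * delta t by rewrite mulr_gt0// delta_gt0.
by rewrite ger0_norm ?WM// ltW// gauss_weight_gt0.
Qed.

Lemma integrable_gauss_weight_delta (l a y : R) : 0 < l -> 0 < a -> 0 < y ->
  mu.-integrable halfline
    (EFin \o (fun t => gauss_weight (l * delta t) * kern_diff a y t)).
Proof.
move=> l0 a0 y0; have [M HM] := gauss_weight_delta_bound l0.
exact: (integrable_kern_diff y0 a0 (@measurable_gauss_weight_delta l) HM).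
Qed.

Lemma cst1_bound t : 0 < t -> `|1 : R| <= 1 * expR (0 * t).
Proof. by move=> _; rewrite mul0r expR0 mulr1 normr1. Qed.

Lemma delta_bound t : 0 < t -> `|delta t| <= 1 * expR (1 / 2 * t).
Proof.
move=> t0; rewrite (ger0_norm (delta_ge0 (ltW t0))) !mul1r.
by have := delta_le t; rewrite (mulrC t).
Qed.

(** For [l = theta * Num.sqrt y / sigma] and [a = r / 2], the sign of
    [odd_integral l a y] decides on which side of [2 * theta * y] the median
    of the variance-gamma distribution lies. The weight
    [gauss_weight (l * delta t)] tends to a constant when [l] tends to
    infinity, and behaves like a multiple of [delta] when [l] tends to 0. *)
Definition odd_integral (l a y : R) : R :=
  \int[mu]_(t in halfline) (gauss_weight (l * delta t) * kern_diff a y t).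

(** Constant weights stand for the gamma distribution, the case [sigma = 0]. *)
Lemma odd_integral_gt0_of_cst (l a y : R) : 0 < l -> 0 < a -> 0 < y ->
  0 <= \int[mu]_(t in halfline) (1 * kern_diff a y t) -> 0 < odd_integral l a y.
Proof.
move=> l0 a0 y0 I1; rewrite /odd_integral.
apply: (crossing_integral (w1 := fun=> 1)
  (w2 := fun t => gauss_weight (l * delta t))
  (rho := fun t => gauss_weight (l * delta t)) (@upcrossing_kern_diff a _ y0)) => //.
- by move=> t _; rewrite mulr1.
- by rewrite delta0 mulr0 gauss_weight0.
- by move=> s t s0 st; apply: gauss_weight_increasing; rewrite ltr_pM2l ?delta_increasing.
- exact: (integrable_kern_diff y0 a0 (measurable_cst _) cst1_bound).
- exact: integrable_gauss_weight_delta.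
Qed.

(** A smaller [l] is a larger [sigma]. *)
Lemma odd_integral_gt0_of_larger (l1 l2 a y : R) : 0 < l2 -> l2 < l1 -> 0 < a -> 0 < y ->
  0 <= odd_integral l1 a y -> 0 < odd_integral l2 a y.
Proof.
move=> l20 l21 a0 y0; have l10 : 0 < l1 by exact: lt_trans l21.
have W1 t : 0 < t -> 0 < gauss_weight (l1 * delta t).
  by move=> t0; rewrite gauss_weight_gt0// mulr_gt0// delta_gt0.
move=> I1; rewrite /odd_integral.
apply: (crossing_integral (w1 := fun t => gauss_weight (l1 * delta t))
  (w2 := fun t => gauss_weight (l2 * delta t))
  (rho := fun t => gauss_weight (l2 * delta t) / gauss_weight (l1 * delta t))
  (@upcrossing_kern_diff a _ y0)) => //.
- by move=> t /W1 Wt; rewrite divfK// gt_eqF.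
- by rewrite delta0 !mulr0 gauss_weight0 mul0r.
- move=> s t s0 st.
  have E z : l2 * delta z = l2 / l1 * (l1 * delta z) by field; rewrite gt_eqF.
  rewrite !E; apply: gauss_weight_ratio_increasing.
  + by rewrite divr_gt0.
  + by rewrite ltr_pdivrMr// mul1r.
  + by apply: mulr_ge0; [exact: ltW|exact: delta_ge0].
  + by rewrite ltr_pM2l// delta_increasing.
- exact: integrable_gauss_weight_delta.
- exact: integrable_gauss_weight_delta.
Qed.

(** The weight [delta] stands for the limit of infinite [sigma]. *)
Lemma integral_delta_gt0_of_odd_integral (l a y : R) : 0 < l -> 1 / 2 < a -> 0 < y ->
  0 <= odd_integral l a y ->
  0 < \int[mu]_(t in halfline) (delta t * kern_diff a y t).
Proof.
move=> l0 a2 y0; have a0 : 0 < a by apply: lt_trans a2; rewrite divr_gt0.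
have W1 t : 0 < t -> 0 < gauss_weight (l * delta t).
  by move=> t0; rewrite gauss_weight_gt0// mulr_gt0// delta_gt0.
move=> I1; apply: (crossing_integral (w1 := fun t => gauss_weight (l * delta t)) (w2 := delta)
  (rho := fun t => delta t / gauss_weight (l * delta t))
  (@upcrossing_kern_diff a _ y0)) => //.
- by move=> t /W1 Wt; rewrite divfK// gt_eqF.
- by rewrite delta0 mul0r.
- move=> s t s0 st.
  have E z : delta z / gauss_weight (l * delta z) =
      l^-1 * (l * delta z / gauss_weight (l * delta z)).
    by rewrite mulrA mulKf// gt_eqF.
  rewrite !E ltr_pM2l ?invr_gt0//; apply: id_gauss_weight_ratio_increasing.
    by apply: mulr_ge0; [exact: ltW|exact: delta_ge0].
  by rewrite ltr_pM2l// delta_increasing.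
- exact: integrable_gauss_weight_delta.
- apply: (integrable_kern_diff y0 a2 _ delta_bound).
  exact: measurable_delta.
Qed.

End kernel.

(** * The limit of large variance *)

Section critical_argument.
Context {R : realType}.
Notation mu := (@lebesgue_measure R).
Notation halfline := `](0 : R), +oo[%classic.
Implicit Types (a b y t l : R).

Lemma delta_kern a y t :
  delta t * kern a y t = (1 - expR (- t)) * kern (a - 1 / 2) y t.
Proof.
rewrite /delta /kern !mulrBl !mul1r -!expRD.
by congr (expR _ - expR _); field.
Qed.

Lemma delta_kernN a y t :
  delta t * kern a y (- t) = (expR t - 1) * kern (a - 1 / 2) y (- t).
Proof.
rewrite !kernN /delta !mulrBl !mul1r -!expRD.
by congr (expR _ - expR _); field.
Qed.

Lemma kern_cvg0 a y : 0 < a -> 0 < y -> kern a y t @[t --> +oo] --> (0 : R).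
Proof.
move=> a0 y0; apply: (squeeze_cvgr _ (cvg_cst 0) (cvg_expRNZ a0)).
by near=> t; rewrite ltW ?kern_gt0//= kern_decay.
Unshelve. all: by end_near. Qed.

Lemma kernN_cvg0 a y : 0 < y -> kern a y (- t) @[t --> +oo] --> (0 : R).
Proof.
move=> y0; have [C C0 HC] := kernN_decay a y0.
have lC : C * expR (- t) @[t --> +oo] --> (0 : R).
  by rewrite -(mulr0 C); apply: cvgMr; exact: cvgr_expR.
apply: (squeeze_cvgr _ (cvg_cst 0) lC).
near=> t; rewrite ltW ?kern_gt0//= HC//.
Unshelve. all: by end_near. Qed.

Lemma Rintegral_ge0_derivative (F f : R -> R) (l : R) :
  (forall x : R, is_derive x 1 F (f x)) -> continuous f ->
  (forall x : R, 0 <= x -> 0 <= f x) -> F x @[x --> +oo] --> l ->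
  \int[mu]_(x in halfline) f x = l - F 0.
Proof. by move=> dF cf f0 Fl; rewrite /Rintegral (integral_ge0_derivative dF cf f0 Fl). Qed.

(** For [y = a - 1 / 2] the integrand is an exact derivative. *)
Lemma integral_delta_kern b : 0 < b ->
  \int[mu]_(t in halfline) (delta t * kern (b + 1 / 2) b t) = kern b b 0 / b.
Proof.
move=> b0.
have dF (x : R) : is_derive x 1 (fun t => - (kern b b t / b))
    (delta x * kern (b + 1 / 2) b x).
  rewrite delta_kern addrK.
  notypeclasses refine (der_eq (der_opp (der_mul (der_kern b b x) (der_cst b^-1 x))) _).
  by field; rewrite gt_eqF.
have cf : continuous (fun t => delta t * kern (b + 1 / 2) b t).
  by move=> t; apply: cvgM; [exact: continuous_delta|exact: continuous_kern].
have Fl : - (kern b b t / b) @[t --> +oo] --> (0 : R).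
  rewrite -oppr0; apply: cvgN; rewrite -(mul0r b^-1).
  by apply: cvgMl; exact: kern_cvg0.
rewrite (Rintegral_ge0_derivative dF cf _ Fl) => [|t t0].
  by rewrite sub0r opprK.
by rewrite mulr_ge0 ?delta_ge0// ltW// kern_gt0.
Qed.

Lemma integral_delta_kernN b : 0 < b ->
  \int[mu]_(t in halfline) (delta t * kern (b + 1 / 2) b (- t)) = kern b b 0 / b.
Proof.
move=> b0.
have dF (x : R) : is_derive x 1 (fun t => - (kern b b (- t) / b))
    (delta x * kern (b + 1 / 2) b (- x)).
  rewrite delta_kernN addrK.
  notypeclasses refine (der_eq (der_opp (der_mul (der_kernN b b x) (der_cst b^-1 x))) _).
  by field; rewrite gt_eqF.
have cf : continuous (fun t => delta t * kern (b + 1 / 2) b (- t)).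
  by move=> t; apply: cvgM; [exact: continuous_delta|exact: continuous_kernN].
have Fl : - (kern b b (- t) / b) @[t --> +oo] --> (0 : R).
  rewrite -oppr0; apply: cvgN; rewrite -(mul0r b^-1).
  by apply: cvgMl; exact: kernN_cvg0.
rewrite (Rintegral_ge0_derivative dF cf _ Fl) => [|t t0].
  by rewrite sub0r opprK oppr0.
by rewrite mulr_ge0 ?delta_ge0// ltW// kern_gt0.
Qed.

Lemma integral_delta_kern_diff_critical b : 0 < b ->
  \int[mu]_(t in halfline) (delta t * kern_diff (b + 1 / 2) b t) = 0.
Proof.
move=> b0; rewrite (Rintegral_kern_diff b0 _ measurable_delta delta_bound).
  by rewrite integral_delta_kern// integral_delta_kernN// subrr.
by rewrite ltrDr.
Qed.

(** If it were nonnegative, then passing to the weight [delta] would make it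
    positive, whereas the integral with that weight vanishes. *)
Lemma odd_integral_critical_lt0 l a : 0 < l -> 1 / 2 < a ->
  odd_integral l a (a - 1 / 2) < 0.
Proof.
move=> l0 a2; rewrite ltNge; apply/negP => I0.
have b0 : 0 < a - 1 / 2 by rewrite subr_gt0.
have := integral_delta_gt0_of_odd_integral l0 a2 b0 I0.
have Z := integral_delta_kern_diff_critical b0.
by move: Z; rewrite {1}subrK => ->; rewrite ltxx.
Qed.

Lemma kern_factor a y b t : kern a y t = kern a b t * expR (- ((y - b) * expR (- t))).
Proof. by rewrite /kern -expRD; congr expR; ring. Qed.

(** Passing from [b = a - 1 / 2] to [y] multiplies the two parts of the
    integrand by factors that lie above, respectively below,
    [expR (- (y - b))]; at [b] the integral vanishes. *)
Lemma integral_delta_kern_diff_gt0 a y : 1 / 2 < a -> a - 1 / 2 < y ->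
  0 < \int[mu]_(t in halfline) (delta t * kern_diff a y t).
Proof.
move=> a2 ay; pose b := a - 1 / 2.
have b0 : 0 < b by rewrite subr_gt0.
have y0 : 0 < y by exact: lt_trans ay.
have intb := integrable_kern_diff b0 a2 measurable_delta delta_bound.
have inty := integrable_kern_diff y0 a2 measurable_delta delta_bound.
have [intc E] := Rintegral_comb (expR (- (y - b))) intb inty.
have : 0 < \int[mu]_(t in halfline)
    (delta t * kern_diff a y t - expR (- (y - b)) * (delta t * kern_diff a b t)).
  have pos t : 0 < t ->
      0 < delta t * kern_diff a y t - expR (- (y - b)) * (delta t * kern_diff a b t).
    move=> t0; rewrite mulrCA -mulrBr mulr_gt0 ?delta_gt0// /kern_diff.
    rewrite (kern_factor a y b t) (kern_factor a y b (- t)) opprK.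
    have yb : 0 < y - b by rewrite subr_gt0.
    have e1 : expR (- (y - b)) < expR (- ((y - b) * expR (- t))).
      by rewrite ltr_expR ltrN2 gtr_pMr// expR_lt1 oppr_lt0.
    have e2 : expR (- ((y - b) * expR t)) < expR (- (y - b)).
      by rewrite ltr_expR ltrN2 ltr_pMr// expR_gt1.
    rewrite [X in 0 < X](_ : _ = kern a b t *
        (expR (- ((y - b) * expR (- t))) - expR (- (y - b))) + kern a b (- t) *
        (expR (- (y - b)) - expR (- ((y - b) * expR t)))); last by ring.
    by rewrite addr_gt0// mulr_gt0 ?kern_gt0// subr_gt0.
  by apply: (Rintegral_gt0 (a := 0)) => // t /pos// /ltW.
have Z := integral_delta_kern_diff_critical b0.
by move: Z; rewrite {1}/b subrK => Z; rewrite E Z mulr0 subr0.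
Qed.

Lemma integral_halfline_le (f : R -> R) (M : \bar R) :
  measurable_fun halfline f -> (forall t : R, 0 < t -> 0 <= f t) ->
  (forall T : R, 0 < T -> (\int[mu]_(t in `]0%R, T]) (f t)%:E <= M)%E) ->
  (\int[mu]_(t in halfline) (f t)%:E <= M)%E.
Proof.
move=> mf f0 fM; pose I n : set (measurableTypeR R) := `]0, n.+1%:R]%classic.
have Idef : halfline = \bigcup_n I n.
  apply/seteqP; split => t /=.
    rewrite in_itv/= andbT => t0; exists (Num.truncn t) => //=.
    by rewrite /I/= in_itv/= t0 ltW// truncnS_gt.
  by move=> [n _]; rewrite /I/= !in_itv/= andbT => /andP[].
have cvgI : (\int[mu]_(t in I n) (f t)%:E @[n --> \oo] -->
    \int[mu]_(t in \bigcup_n I n) (f t)%:E)%E.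
  apply: (@ge0_nondecreasing_set_cvg_integral _ _ _ I (EFin \o f)) => //.
  - move=> m n mn; rewrite subsetEset; apply: subset_itvl.
    by rewrite bnd_simp ler_nat.
  - by move=> n; exact: measurable_itv.
  - move=> n; apply/measurable_EFinP; apply: measurable_funS mf.
      exact: measurable_halfline.
    by rewrite Idef; exact: bigcup_sup.
  - by move=> n t; rewrite /I/= in_itv/= lee_fin => /andP[+ _]; exact: f0.
rewrite Idef; apply: (cvge_le _ cvgI).
by apply: nearW => n; exact: fM.
Qed.

(** On [`]0, T]] the weight [gauss_weight (l * delta t)] is at least
    [2 * l * g * delta t] with [g] close to 1 for small [l], and everywhere
    it is at most [2 * l * delta t]. The left-hand side may be infinite,
    which is why the bound is reached through [`]0, T]]. *)
Lemma integral_delta_kern_le a y : 0 < a -> 0 < y ->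
  (forall l, 0 < l -> odd_integral l a y <= 0) ->
  (\int[mu]_(t in halfline) (delta t * kern a y t)%:E <=
   (\int[mu]_(t in halfline) (delta t * kern a y (- t)))%:E)%E.
Proof.
move=> a0 y0 Il; set M := \int[mu]_(t in halfline) _.
have M0 : 0 <= M.
  apply: Rintegral_ge0 => t /=; rewrite in_itv/= andbT => t0.
  by rewrite mulr_ge0 ?(ltW (kern_gt0 _ _ _))// delta_ge0// ltW.
have dk0 t : 0 < t -> 0 <= delta t * kern a y t.
  by move=> t0; rewrite mulr_ge0 ?(ltW (kern_gt0 _ _ _))// delta_ge0// ltW.
have mdk : measurable_fun halfline (fun t => delta t * kern a y t).
  apply: measurable_funM; first exact: measurable_delta.
  by apply: measurable_funTS; exact: continuous_measurable_fun (@continuous_kern _ a y).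
apply: integral_halfline_le => // T T0.
have dT0 : 0 < delta T by exact: delta_gt0.
apply/lee_addgt0Pr => e e0; rewrite -EFinD.
have Me : 0 < M + e by rewrite ltr_wpDl.
(* small enough for the Gaussian factor to exceed M / (M + e) on ]0, T] *)
pose l := e / ((M + e) * (delta T ^+ 2 + 1)).
have dT1 : 0 < delta T ^+ 2 + 1 by rewrite ltr_wpDl ?sqr_ge0.
have l0 : 0 < l by rewrite divr_gt0// mulr_gt0.
have lM : l * ((M + e) * (delta T ^+ 2 + 1)) = e by rewrite divfK// gt_eqF// mulr_gt0.
have l1 : l <= 1.
  rewrite ler_pdivrMr ?mulr_gt0// mul1r.
  have : 0 <= (M + e) * delta T ^+ 2 by rewrite mulr_ge0 ?ltW ?exprn_gt0.
  by nra.
pose g := gauss_fun (l * delta T).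
have g0 : 0 < g by exact: gauss_fun_gt0.
have gM : M <= (M + e) * g.
  apply: (@le_trans _ _ ((M + e) * (1 - (l * delta T) ^+ 2))); last first.
    rewrite ler_pM2l// /g /gauss_fun.
    by have := expR_ge1Dx (- (l * delta T) ^+ 2).
  have : (M + e) * (l * delta T) ^+ 2 <= e; last by lra.
  rewrite -[leRHS]lM exprMn.
  apply: (@le_trans _ _ ((M + e) * (l * delta T ^+ 2))).
    rewrite ler_pM2l// ler_pM2r ?exprn_gt0// expr2.
    by rewrite ger_pMr.
  have : 0 < l * (M + e) by rewrite mulr_gt0.
  by nra.
have lg0 : 0 < 2 * l * g by rewrite mulr_gt0// mulr_gt0.
have [K HK] := gauss_weight_delta_bound l0.
have mW := @measurable_gauss_weight_delta _ l.
have intA := integrable_kern y0 a0 mW HK.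
have intB := integrable_kernN a y0 mW HK.
have IB : \int[mu]_(t in halfline) (gauss_weight (l * delta t) * kern a y (- t)) <= 2 * l * M.
  have intd := integrable_kernN a y0 (@measurable_delta R) (@delta_bound R).
  rewrite /M -RintegralZl//; apply: le_Rintegral => //.
    by have := integrableZl measurable_halfline (2 * l) intd.
  move=> t /=; rewrite in_itv/= andbT => t0.
  rewrite mulrA ler_wpM2r ?(ltW (kern_gt0 _ _ _))//.
  rewrite -(mulrA 2 l); apply: gauss_weight_le.
  by rewrite mulr_ge0 ?(ltW l0)// delta_ge0// ltW.
have IA : \int[mu]_(t in halfline) (gauss_weight (l * delta t) * kern a y t) <= 2 * l * M.
  apply: le_trans IB; rewrite -subr_le0 -(Rintegral_kern_diff y0 a0 mW HK).
  exact: Il.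
have W0 t : 0 < t -> 0 <= gauss_weight (l * delta t) * kern a y t.
  move=> t0; rewrite mulr_ge0 ?(ltW (kern_gt0 _ _ _))//.
  by rewrite ltW// gauss_weight_gt0// mulr_gt0// delta_gt0.
have sub : `]0, T] `<=` halfline by move=> t /=; rewrite !in_itv/= andbT => /andP[].
have mT : measurable (`]0, T]%classic : set (measurableTypeR R)) by exact: measurable_itv.
have H : ((2 * l * g)%:E * \int[mu]_(t in `]0%R, T]) (delta t * kern a y t)%:E <=
    (2 * l * M)%:E)%E.
  apply: (@le_trans _ _
    (\int[mu]_(t in halfline) (gauss_weight (l * delta t) * kern a y t)%:E)%E); last first.
    rewrite -[leLHS]fineK ?lee_fin//.
    by apply: integrable_fin_num intA; exact: measurable_halfline.
  apply: (@le_trans _ _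
    (\int[mu]_(t in `]0%R, T]) (gauss_weight (l * delta t) * kern a y t)%:E)%E); last first.
    apply: ge0_subset_integral => //.
    - by case/integrableP : intA.
    - by move=> t /=; rewrite in_itv/= andbT lee_fin; exact: W0.
  rewrite -ge0_integralZl_EFin//; last 3 first.
  - by move=> t /= /sub /=; rewrite in_itv/= andbT lee_fin; exact: dk0.
  - by apply/measurable_EFinP; apply: measurable_funS sub mdk; exact: measurable_halfline.
  - exact: ltW.
  apply: ge0_le_integral => //.
  - move=> t /= /sub /=; rewrite in_itv/= andbT => t0; rewrite -EFinM lee_fin.
    by rewrite mulr_ge0 ?dk0// (ltW lg0).
  - apply/measurable_EFinP; apply: measurable_funM => //.
    by apply: measurable_funS sub mdk; exact: measurable_halfline.
  - apply/measurable_EFinP; apply: measurable_funS sub (integrable_measurable intA).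
    exact: measurable_halfline.
  - move=> t /=; rewrite in_itv/= => /andP[t0 tT]; rewrite -EFinM lee_fin.
    have ld : 0 <= l * delta t by rewrite mulr_ge0 ?(ltW l0)// delta_ge0// ltW.
    rewrite mulrA ler_wpM2r ?(ltW (kern_gt0 _ _ _))//.
    apply: le_trans (gauss_weight_ge ld).
    rewrite (_ : 2 * l * g * delta t = 2 * (l * delta t) * g); last by ring.
    have gle : g <= gauss_fun (l * delta t).
      have ldT : 0 <= l * delta T by exact: ltW (mulr_gt0 l0 dT0).
      have dtT : delta t <= delta T.
        by move: tT; rewrite le_eqVlt => /predU1P[->//|/delta_increasing/ltW].
      rewrite /g /gauss_fun ler_expR lerN2.
      by apply: lerXn2r; rewrite ?nnegrE// ler_pM2l.
    by apply: ler_wpM2l gle; rewrite mulr_ge0.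
move: H; case: (\int[mu]_(t in _) _)%E => [k| |]; last by rewrite leNye.
- rewrite -EFinM !lee_fin => H.
  have : g * k <= M by rewrite -(ler_pM2l (mulr_gt0 (ltr0Sn R 1) l0)) mulrA.
  by move=> gk; rewrite -(ler_pM2l g0) (le_trans gk)// mulrC.
- by rewrite gt0_muley ?lte_fin// leye_eq.
Qed.

(** For [a <= 1 / 2] the integrand is bounded below by a positive constant
    from 1 on. *)
Lemma integral_delta_kern_infty a y : 0 < y -> a <= 1 / 2 ->
  (\int[mu]_(t in halfline) (delta t * kern a y t)%:E = +oo)%E.
Proof.
move=> y0 a2; apply/eqP; rewrite eq_le leey/=.
pose c : R := (1 - expR (- 1)) * expR (- y).
have c0 : 0 < c by rewrite mulr_gt0 ?expR_gt0// subr_gt0 expR_lt1 oppr_lt0.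
have mdk : measurable_fun halfline (fun t => delta t * kern a y t).
  apply: measurable_funM; first exact: measurable_delta.
  by apply: measurable_funTS; exact: continuous_measurable_fun (@continuous_kern _ a y).
have m1 : measurable (`[1, +oo[%classic : set (measurableTypeR R)) by exact: measurable_itv.
have sub : `[1, +oo[ `<=` halfline.
  by move=> t /=; rewrite !in_itv/= !andbT; exact: lt_le_trans.
apply: (@le_trans _ _ (\int[mu]_(t in `[1%R, +oo[) (delta t * kern a y t)%:E)%E); last first.
  apply: ge0_subset_integral => //; first exact/measurable_EFinP.
  move=> t /=; rewrite in_itv/= andbT lee_fin => t0.
  by rewrite mulr_ge0 ?(ltW (kern_gt0 _ _ _))// delta_ge0// ltW.
apply: (@le_trans _ _ (\int[mu]_(t in `[1%R, +oo[) (cst c%:E t))%E); last first.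
  apply: ge0_le_integral => //.
  - by move=> t _; rewrite lee_fin ltW.
  - by apply/measurable_EFinP; apply: measurable_funS sub mdk; exact: measurable_halfline.
  move=> t /=; rewrite in_itv/= andbT => t1; rewrite lee_fin delta_kern /kern.
  have t0 : 0 < t by exact: lt_le_trans t1.
  apply: ler_pM; rewrite ?expR_ge0//.
    by rewrite lerD2l lerN2 ler_expR lerN2.
  rewrite ler_expR.
  have : expR (- t) <= 1 by rewrite expR_le1; lra.
  by nra.
rewrite integral_cst// [X in (_ * X)%E](_ : _ = +oo%E) ?gt0_muley ?lte_fin//.
transitivity (mu `[1%R, +oo[); first by [].
by rewrite lebesgue_measure_itv/= ltry addye.
Qed.

Lemma odd_integral_eventually_gt0 a y : 0 < a -> 0 < y -> a - 1 / 2 < y ->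
  exists2 l, 0 < l & 0 < odd_integral l a y.
Proof.
move=> a0 y0 ay; apply: contrapT => no.
have Il l : 0 < l -> odd_integral l a y <= 0.
  by move=> l0; rewrite leNgt; apply/negP => Il; apply: no; exists l.
have le := integral_delta_kern_le a0 y0 Il.
have [a2|a2] := leP a (1 / 2).
  by move: le; rewrite integral_delta_kern_infty// leNgt ltry.
have := integral_delta_kern_diff_gt0 a2 ay.
rewrite (Rintegral_kern_diff y0 a2 (@measurable_delta R) (@delta_bound R)) subr_gt0.
apply/negP; rewrite -leNgt -lee_fin; apply: le_trans le.
rewrite fineK//; apply: integrable_fin_num.
  exact: measurable_halfline.
exact: (integrable_kern y0 a2 (@measurable_delta R) (@delta_bound R)).
Qed.

End critical_argument.

(** * The two branches of a level of the log-gamma density *)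

Section gamma_parametrization.
Context {R : realType}.
Notation mu := (@lebesgue_measure R).
Notation halfline := `](0 : R), +oo[%classic.
Implicit Types (t y : R).

(** For [a = y], the exponent of [kern y y t] is [- y * (t + expR (- t))]. A
    level of the convex function [u + expR (- u)] is attained at a positive
    and at a negative argument, [lower_gap t] and [- upper_gap t], when these
    are at distance [t]. In terms of a gamma variable [y * expR (- u)], they
    are the gaps on the logarithmic scale between [y] and the lower and upper
    points of equal density. *)
Definition lower_gap t : R := ln ((expR t - 1) / t).
Definition upper_gap t : R := t - lower_gap t.
Definition dlower_gap t : R := expR t / (expR t - 1) - t^-1.

Lemma expR_sub1_gt t : 0 < t -> t < expR t - 1.
Proof. by move=> t0; rewrite ltrBrDl expR_gt1Dx// gt_eqF. Qed.

Lemma expR_sub1_gt0 t : 0 < t -> 0 < expR t - 1.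
Proof. by move=> t0; exact: lt_trans (expR_sub1_gt t0). Qed.

Lemma expR_lower_gap t : 0 < t -> expR (lower_gap t) = (expR t - 1) / t.
Proof. by move=> t0; rewrite lnK// posrE divr_gt0// expR_sub1_gt0. Qed.

Lemma expRN_lower_gap t : 0 < t -> expR (- lower_gap t) = t / (expR t - 1).
Proof. by move=> t0; rewrite expRN expR_lower_gap// invf_div. Qed.

(** Both points lie on the same level. *)
Lemma gap_level t : 0 < t ->
  lower_gap t + expR (- lower_gap t) = expR (upper_gap t) - upper_gap t.
Proof.
move=> t0; have E0 := expR_sub1_gt0 t0.
rewrite /upper_gap expRD expRN_lower_gap//.
rewrite (_ : expR t * (t / (expR t - 1)) = t + t / (expR t - 1)); last first.
  by field; rewrite gt_eqF.
by ring.
Qed.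

Lemma der_lower_gap t : 0 < t -> is_derive t 1 lower_gap (dlower_gap t).
Proof.
move=> t0; have E0 := expR_sub1_gt0 t0; rewrite /lower_gap /dlower_gap.
der.
- by rewrite divr_gt0.
- by rewrite gt_eqF.
by field; rewrite !gt_eqF.
Qed.

Lemma der_upper_gap t : 0 < t -> is_derive t 1 upper_gap (1 - dlower_gap t).
Proof. by move=> /der_lower_gap d; exact: der_add (der_id t) (der_opp d). Qed.

Lemma dlower_gapE t : 0 < t ->
  dlower_gap t = (t * expR t - expR t + 1) / (t * (expR t - 1)).
Proof.
move=> t0; have E0 := expR_sub1_gt0 t0.
by rewrite /dlower_gap; field; rewrite !gt_eqF.
Qed.

Lemma dupper_gapE t : 0 < t ->
  1 - dlower_gap t = (expR t - 1 - t) / (t * (expR t - 1)).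
Proof.
move=> t0; have E0 := expR_sub1_gt0 t0.
by rewrite /dlower_gap; field; rewrite !gt_eqF.
Qed.

Lemma dlower_gap_gt0 t : 0 < t -> 0 < dlower_gap t.
Proof.
move=> t0; have E0 := expR_sub1_gt0 t0.
rewrite dlower_gapE// divr_gt0// ?mulr_gt0//.
have : 1 - t < expR (- t) by rewrite expR_gt1Dx// oppr_eq0 gt_eqF.
rewrite -(ltr_pM2l (expR_gt0 t)) expRxMexpNx_1; lra.
Qed.

Lemma dupper_gap_gt0 t : 0 < t -> 0 < 1 - dlower_gap t.
Proof.
move=> t0; have E0 := expR_sub1_gt0 t0.
by rewrite dupper_gapE// divr_gt0 ?mulr_gt0// subr_gt0 expR_sub1_gt.
Qed.

Lemma continuous_dlower_gap t : 0 < t -> {for t, continuous dlower_gap}.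
Proof.
move=> t0; have E0 := expR_sub1_gt0 t0.
apply: (@der_continuous _ _ _ _); rewrite /dlower_gap.
repeat der_step; by rewrite gt_eqF.
Qed.

Lemma lower_gap_gt0 t : 0 < t -> 0 < lower_gap t.
Proof.
by move=> t0; rewrite ln_gt0// ltr_pdivlMr// mul1r expR_sub1_gt.
Qed.

Lemma lower_gap_lt t : 0 < t -> lower_gap t < t.
Proof.
move=> t0; rewrite -ltr_expR expR_lower_gap// ltr_pdivrMr//.
have : 1 - t < expR (- t) by rewrite expR_gt1Dx// oppr_eq0 gt_eqF.
by rewrite -(ltr_pM2l (expR_gt0 t)) expRxMexpNx_1; lra.
Qed.

Lemma lower_gap_ge t : 0 < t -> ln (t / 2) <= lower_gap t.
Proof.
move=> t0; rewrite ler_ln ?posrE ?divr_gt0 ?expR_sub1_gt0//.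
rewrite ler_pdivlMr//.
by have := expR_ge1Dxn 1 (ltW t0); rewrite !factS fact0 !mul1n; lra.
Qed.

Lemma upper_gap_ge t : 0 < t -> ln t <= upper_gap t.
Proof.
move=> t0; rewrite -ler_expR lnK ?posrE// /upper_gap expRD expRN_lower_gap//.
have E0 := expR_sub1_gt0 t0.
by rewrite mulrA ler_pdivlMr// mulrC ler_pM2r//; lra.
Qed.

(** The bound [F t <= t] forces the limit 0 of [F] at 0. *)
Lemma substitution_halfline (F f G : R -> R) :
  (forall t : R, 0 < t -> is_derive t 1 F (f t)) ->
  (forall t : R, 0 < t -> 0 < f t) ->
  (forall t : R, 0 < t -> {for t, continuous f}) ->
  (forall t : R, 0 < t -> 0 < F t) ->
  (forall t : R, 0 < t -> F t <= t) ->
  (forall y : R, exists2 t : R, 0 < t & y <= F t) ->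
  continuous G -> (forall t : R, 0 <= G t) ->
  mu.-integrable halfline (EFin \o G) ->
  mu.-integrable halfline (EFin \o (fun t => G (F t) * f t)) /\
  \int[mu]_(t in halfline) G t = \int[mu]_(t in halfline) (G (F t) * f t).
Proof.
move=> dF f0 cf F0 Ft Fy cG G0 intG.
have E : (\int[mu]_(y in halfline) (G y)%:E =
          \int[mu]_(t in halfline) (G (F t) * f t)%:E)%E.
  apply: (@substitution_increasing _ halfline F f G) => //.
  - exact: interval_is_interval.
  - by move=> t t0; rewrite /= in_itv/= andbT F0.
  - move=> y /=; rewrite in_itv/= andbT => y0; have [t t0 yt] := Fy y.
    by exists y, t; split => //; exact: Ft.
  - by move=> y _; exact: cG.
split; last by rewrite /Rintegral E.
apply/integrableP; split.
  apply/measurable_EFinP; apply: open_continuous_measurable_fun.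
    exact: interval_open.
  move=> t; rewrite inE/= in_itv/= andbT => t0.
  apply: cvgM; last exact: cf.
  by apply: (@continuous_comp _ _ _ F G); [exact: der_continuous (dF _ t0)|exact: cG].
under eq_integral.
  move=> t; rewrite inE/= in_itv/= andbT => t0.
  rewrite ger0_norm; last by rewrite mulr_ge0// ltW// f0.
  over.
rewrite /= -E; case/integrableP: intG => _; apply: le_lt_trans.
by under [leRHS]eq_integral do rewrite /= ger0_norm//.
Qed.

Lemma substitution_lower_gap (G : R -> R) : continuous G ->
  (forall t : R, 0 <= G t) -> mu.-integrable halfline (EFin \o G) ->
  mu.-integrable halfline (EFin \o (fun t => G (lower_gap t) * dlower_gap t)) /\
  \int[mu]_(t in halfline) G t =
  \int[mu]_(t in halfline) (G (lower_gap t) * dlower_gap t).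
Proof.
apply: substitution_halfline.
- exact: der_lower_gap.
- exact: dlower_gap_gt0.
- exact: continuous_dlower_gap.
- exact: lower_gap_gt0.
- by move=> t /lower_gap_lt/ltW.
move=> y; exists (2 * expR y); first by rewrite mulr_gt0// expR_gt0.
have e0 : 0 < 2 * expR y by rewrite mulr_gt0// expR_gt0.
apply: le_trans (lower_gap_ge e0).
by rewrite mulrAC divff// mul1r expRK.
Qed.

Lemma substitution_upper_gap (G : R -> R) : continuous G ->
  (forall t : R, 0 <= G t) -> mu.-integrable halfline (EFin \o G) ->
  mu.-integrable halfline (EFin \o (fun t => G (upper_gap t) * (1 - dlower_gap t))) /\
  \int[mu]_(t in halfline) G t =
  \int[mu]_(t in halfline) (G (upper_gap t) * (1 - dlower_gap t)).
Proof.
apply: substitution_halfline.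
- exact: der_upper_gap.
- exact: dupper_gap_gt0.
- by move=> t t0; apply: cvgB; [exact: cvg_cst|exact: continuous_dlower_gap].
- by move=> t t0; rewrite subr_gt0 lower_gap_lt.
- by move=> t t0; rewrite gerBl ltW// lower_gap_gt0.
move=> y; exists (expR y); first exact: expR_gt0.
by apply: le_trans (upper_gap_ge (expR_gt0 y)); rewrite expRK.
Qed.

End gamma_parametrization.

(** * Bounds for the median of the gamma distribution *)

Section gamma_median.
Context {R : realType}.
Notation mu := (@lebesgue_measure R).
Notation halfline := `](0 : R), +oo[%classic.
Implicit Types (a b y t : R).

Lemma integrable_kern1 a y : 0 < a -> 0 < y ->
  mu.-integrable halfline (EFin \o kern a y).
Proof.
move=> a0 y0; have := integrable_kern y0 a0 (measurable_cst _) (@cst1_bound R).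
by apply: eq_integrable; [exact: measurable_halfline|move=> t _; rewrite /= mul1r].
Qed.

Lemma integrable_kernN1 a y : 0 < y ->
  mu.-integrable halfline (EFin \o (fun t => kern a y (- t))).
Proof.
move=> y0; have := integrable_kernN a y0 (measurable_cst _) (@cst1_bound R).
by apply: eq_integrable; [exact: measurable_halfline|move=> t _; rewrite /= mul1r].
Qed.

Lemma Rintegral_kern_diff1 a y : 0 < a -> 0 < y ->
  \int[mu]_(t in halfline) (1 * kern_diff a y t) =
  \int[mu]_(t in halfline) kern a y t - \int[mu]_(t in halfline) kern a y (- t).
Proof.
move=> a0 y0; rewrite (Rintegral_kern_diff y0 a0 (measurable_cst _) (@cst1_bound R)).
by congr (_ - _); apply: eq_Rintegral => t _; rewrite mul1r.
Qed.

(** Minus [ln (kern y y (lower_gap t)) / y]. *)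
Definition level t : R := lower_gap t + expR (- lower_gap t).

Lemma kern_lower_gap a y t :
  kern a y (lower_gap t) = expR (- (y * level t)) * expR (- ((a - y) * lower_gap t)).
Proof. by rewrite /kern /level -expRD; congr expR; ring. Qed.

Lemma kernN_upper_gap a y t : 0 < t ->
  kern a y (- upper_gap t) = expR (- (y * level t)) * expR ((a - y) * upper_gap t).
Proof.
move=> t0; rewrite kernN /level gap_level// -expRD; congr expR; ring.
Qed.

(** When the shape is equal to [y], the substitutions by the two gaps give
    both halves the same weight [expR (- (y * level t))], so that only the
    derivatives of the gaps have to be compared. The subtracted constant is
    [2 / 3] times the integral of [(1 - expR (- t)) * kern b b t], an exact
    derivative; it is the largest multiple for which the comparison holds
    close to 0. *)
Lemma integral_kernN_le b : 0 < b ->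
  \int[mu]_(t in halfline) kern b b (- t) <=
  \int[mu]_(t in halfline) kern b b t - 2 / 3 * (expR (- b) / b).
Proof.
move=> b0.
have int1 := integrable_kern1 b0 b0.
have intd : mu.-integrable halfline (EFin \o (fun t => (1 - expR (- t)) * kern b b t)).
  have b2 : 1 / 2 < b + 1 / 2 by lra.
  have := integrable_kern b0 b2 (@measurable_delta R) (@delta_bound R).
  apply: eq_integrable; first exact: measurable_halfline.
  by move=> t _; rewrite /= delta_kern addrK.
have [intc] := Rintegral_comb (2 / 3) intd int1.
rewrite [X in _ = _ - 2 / 3 * X](_ : _ = expR (- b) / b); last first.
  rewrite (_ : expR (- b) = kern b b 0); last first.
    by rewrite /kern mulr0 !oppr0 expR0 mulr1 add0r.
  rewrite -(integral_delta_kern b0); apply: eq_Rintegral => t _.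
  by rewrite delta_kern addrK.
move=> <-; pose G t := kern b b t - 2 / 3 * ((1 - expR (- t)) * kern b b t).
have GE t : G t = kern b b t * (1 / 3 + 2 / 3 * expR (- t)) by rewrite /G; field.
have cG : continuous G.
  move=> t; have dk := der_kern b b t.
  have de : is_derive t 1 (fun t => 1 - expR (- t)) (expR (- t)) by der; ring.
  exact: (der_continuous (der_add dk (der_opp (der_mul (der_cst (2 / 3) t) (der_mul de dk))))).
have G0 t : 0 <= G t.
  rewrite GE; apply: mulr_ge0; first exact: ltW (kern_gt0 _ _ _).
  by have := expR_gt0 (- t); lra.
have [intl ->] := substitution_lower_gap cG G0 intc.
have [intu ->] := substitution_upper_gap (continuous_kernN (a := b) (y := b))
  (fun t => ltW (kern_gt0 b b (- t))) (integrable_kernN1 b b0).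
apply: le_Rintegral => // t /=; rewrite in_itv/= andbT => t0.
rewrite GE kern_lower_gap kernN_upper_gap// subrr !mul0r oppr0 expR0 !mulr1.
rewrite -mulrA ler_pM2l ?expR_gt0// expRN_lower_gap//.
have E0 := expR_sub1_gt0 t0.
rewrite dupper_gapE// dlower_gapE// -subr_ge0.
have -> : (1 / 3 + 2 / 3 * (t / (expR t - 1))) *
    ((t * expR t - expR t + 1) / (t * (expR t - 1))) -
    (expR t - 1 - t) / (t * (expR t - 1)) =
    expR t * ((t - 4) * expR t + 2 * t ^+ 2 + 8 - (t + 4) * expR (- t)) /
      (3 * t * (expR t - 1) ^+ 2).
  by rewrite expRN; field; rewrite !gt_eqF ?expR_gt0.
rewrite divr_ge0//; last by rewrite !mulr_ge0 ?sqr_ge0// ltW.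
by rewrite mulr_ge0 ?expR_ge0//; apply: gap_numerator_ge0; exact: ltW.
Qed.

Lemma shift_integral (G : R -> R) (c : R) : continuous G -> (forall t : R, 0 <= G t) ->
  (\int[mu]_(t in `[c, +oo[) (G t)%:E = \int[mu]_(t in `[0%R, +oo[) (G (t + c))%:E)%E.
Proof.
move=> cG G0; pose F (t : R) := t + c.
have dF (t : R) : is_derive t 1 F 1 by rewrite /F; der; ring.
have F'E : derive1 F = cst 1 by apply/funext => t; exact: der_derive1 (dF t).
have := @increasing_ge0_integration_by_substitutiony R F G 0.
rewrite /F add0r => ->.
- apply: eq_integral => t _; rewrite -/F !fctE F'E mulr1//.
- by move=> s t _ _; rewrite ltrD2r.
- by rewrite -/F F'E => t _; exact: cvg_cst.
- by rewrite -/F F'E; exact: is_cvg_cst.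
- by rewrite -/F F'E; exact: is_cvg_cst.
- split => [t _|]; first by have [] := dF t.
  by apply: cvg_at_right_filter; exact: der_continuous (dF 0).
- exact: cvg_addrr.
- by apply: continuous_subspaceT => t; exact: cG.
- by move=> t _; exact: G0.
Qed.

Lemma kern_le a t : 0 < a -> kern a a t <= expR (- a).
Proof.
move=> a0; rewrite ler_expR; have := expR_ge1Dx (- t).
by rewrite -(ler_pM2l a0); lra.
Qed.

Lemma integral_shift_le (G : R -> R) (c K : R) : 0 <= c -> continuous G ->
  (forall t : R, 0 <= G t) -> (forall t : R, G t <= K) ->
  (\int[mu]_(t in halfline) (G (t - c))%:E <=
   \int[mu]_(t in halfline) (G t)%:E + (K * c)%:E)%E.
Proof.
move=> c0 cG G0 GK.
have mG (D : set (measurableTypeR R)) : measurable_fun D (fun t => (G t)%:E).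
  by apply/measurable_EFinP/measurable_funTS; exact: continuous_measurable_fun.
have cGc : continuous (fun t => G (t - c)).
  by move=> t; apply: (@continuous_comp _ _ _ (fun t => t - c) G);
    [exact: der_continuous (der_add (der_id t) (der_cst (- c) t))|exact: cG].
rewrite integral_itv_obnd_cbnd; last first.
  by apply/measurable_EFinP/measurable_funTS; exact: continuous_measurable_fun.
rewrite -shift_integral// integral_itv_obnd_cbnd; last exact: mG.
have c0' : (BLeft (- c) <= BLeft 0)%O by rewrite bnd_simp oppr_le0.
rewrite (_ : `[(- c)%R, +oo[%classic = `[- c, 0[%classic `|` `[0, +oo[%classic); last first.
  by rewrite (@itv_bndbnd_setU _ _ _ (BLeft 0)).
rewrite ge0_integral_setU//; last 2 first.
- by move=> t _; rewrite lee_fin.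
- apply/disj_setPS => t [] /=; rewrite !in_itv/= andbT => /andP[_ t0].
  by rewrite leNgt t0.
rewrite addeC leeD2l//.
apply: (@le_trans _ _ (\int[mu]_(t in `[(- c)%R, 0%R[) (cst K%:E t))%E).
  apply: ge0_le_integral => //; first by move=> t _; rewrite lee_fin.
  by move=> t _; rewrite lee_fin.
rewrite integral_cst// [X in (_ * X)%E](_ : _ = c%:E)//.
transitivity (mu `[(- c)%R, 0%R[); first by [].
rewrite lebesgue_measure_itv/= lte_fin oppr_lt0; case: ltP => [_|].
  by rewrite -EFinB sub0r opprK.
by move=> c0''; congr EFin; apply/eqP; rewrite eq_le c0 c0''.
Qed.

(** Berg and Pedersen's bound for the median of the gamma distribution of
    shape [a] and rate 1. Replacing [y = a] by [a * expR (- p)] translates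
    the kernel by [p]. Each half loses or gains at most [p * expR (- a)],
    because [kern a a] is at most [expR (- a)], and [p = 1 / (3 * a)] makes
    the total equal to the reserve [2 / 3 * (expR (- a) / a)] left by
    [integral_kernN_le]. *)
Lemma gamma_median_exp_bound a : 0 < a ->
  0 <= \int[mu]_(t in halfline) (1 * kern_diff a (a * expR (- (1 / (3 * a)))) t).
Proof.
move=> a0; pose p : R := 1 / (3 * a); pose y := a * expR (- p).
have p0 : 0 < p by rewrite divr_gt0// mulr_gt0.
have y0 : 0 < y by rewrite mulr_gt0// expR_gt0.
rewrite -/p -/y Rintegral_kern_diff1// subr_ge0.
have kE t : kern a a (t + p) = expR (- (a * p)) * kern a y t.
  by rewrite /kern /y -mulrA -!expRD opprD (addrC (- t)); congr expR; ring.
have kNE t : kern a a (- (t - p)) = expR (- (a * p)) * kern a y (- t).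
  by rewrite -kE opprB addrC.
have intk := integrable_kern1 a0 y0.
have intkN := integrable_kernN1 a y0.
have int1 := integrable_kern1 a0 a0.
have int1N := integrable_kernN1 a a0.
have finE (f : R -> R) : mu.-integrable halfline (EFin \o f) ->
    (\int[mu]_(t in halfline) (f t)%:E = (\int[mu]_(t in halfline) f t)%:E)%E.
  by move=> intf; rewrite fineK//; apply: integrable_fin_num intf; exact: measurable_halfline.
have intZ (f : R -> R) (k : R) : mu.-integrable halfline (EFin \o f) ->
    mu.-integrable halfline (EFin \o (fun t => k * f t)).
  by move=> intf; have := integrableZl measurable_halfline k intf.
have kcont : continuous (fun t => kern a a (t + p)).
  move=> t; apply: (@continuous_comp _ _ _ (fun t => t + p) (kern a a)).
    exact: der_continuous (der_add (der_id t) (der_cst p t)).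
  exact: continuous_kern.
have lower : \int[mu]_(t in halfline) kern a a t <=
    expR (- (a * p)) * \int[mu]_(t in halfline) kern a y t + expR (- a) * p.
  have := integral_shift_le (ltW p0) kcont (fun t => ltW (kern_gt0 _ _ _))
    (fun t => kern_le (t + p) a0).
  under eq_integral do rewrite subrK.
  under [X in (_ <= X + _)%E]eq_integral do rewrite kE.
  by rewrite (finE _ int1) (finE _ (intZ _ _ intk)) RintegralZl// -EFinD lee_fin.
have upper : expR (- (a * p)) * \int[mu]_(t in halfline) kern a y (- t) <=
    \int[mu]_(t in halfline) kern a a (- t) + expR (- a) * p.
  have := integral_shift_le (ltW p0) (continuous_kernN (a := a) (y := a))
    (fun t => ltW (kern_gt0 _ _ _)) (fun t => kern_le (- t) a0).
  under eq_integral do rewrite kNE.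
  by rewrite (finE _ int1N) (finE _ (intZ _ _ intkN)) RintegralZl// -EFinD lee_fin.
have le := integral_kernN_le a0.
rewrite -(ler_pM2l (expR_gt0 (- (a * p)))).
have pE : expR (- a) * p = 1 / 3 * (expR (- a) / a).
  by rewrite /p; field; rewrite gt_eqF.
have arith (I IN L U q k : R) : IN <= I - 2 / 3 * k -> I <= L + q -> U <= IN + q ->
  q = 1 / 3 * k -> U <= L.
  by clear; move=> *; lra.
exact: (arith _ _ _ _ _ _ le lower upper pE).
Qed.

Lemma level_increasing (s t : R) : 0 <= s -> s < t -> level s < level t.
Proof.
have lev1 (x : R) : 0 < x -> 1 < level x.
  move=> x0; have := @expR_gt1Dx _ (- lower_gap x).
  rewrite oppr_eq0 gt_eqF ?lower_gap_gt0// => /(_ isT).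
  by rewrite /level; lra.
rewrite le_eqVlt => /predU1P[<-|s0] st.
  by rewrite {1}/level /lower_gap invr0 mulr0 ln0// oppr0 expR0 add0r lev1.
apply: (@derivative_gt0_increasing _ level
  (fun t => (1 - expR (- lower_gap t)) * dlower_gap t)) => // x /andP[sx _].
  have x0 : 0 < x by exact: lt_le_trans sx.
  have d := der_lower_gap x0.
  notypeclasses refine (der_eq (der_add d (der_exp (der_opp d))) _).
  by ring.
have x0 : 0 < x by exact: lt_trans sx.
rewrite mulr_gt0 ?dlower_gap_gt0// subr_gt0 expR_lt1 oppr_lt0.
exact: lower_gap_gt0.
Qed.

(** The exponential distribution of rate 1 has median [ln 2]. *)
Lemma integral_kern_diff_exponential :
  \int[mu]_(t in halfline) (1 * kern_diff 1 (ln 2) t) = 0.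
Proof.
have c0 : 0 < ln 2 :> R by rewrite ln_gt0// ltr1n.
set c : R := ln 2 in c0 *.
have e2 : expR c = 2 by rewrite /c lnK// posrE.
have dF t : is_derive t 1 (fun t => expR (- (c * expR (- t))) / c) (kern 1 c t).
  by der; rewrite /kern expRD mul1r; field; rewrite gt_eqF.
have dFN t : is_derive t 1 (fun t => - (expR (- (c * expR t)) / c)) (kern 1 c (- t)).
  by der; rewrite kernN mul1r expRD; field; rewrite gt_eqF.
have cvg_exp (f : R -> R) (l : R) : f t @[t --> +oo] --> l ->
    expR (- (c * f t)) / c @[t --> +oo] --> expR (- (c * l)) / c.
  move=> fl.
  have dE : is_derive l 1 (fun z => expR (- (c * z)) / c) (- expR (- (c * l))).
    by der; field; rewrite gt_eqF.
  exact: cvg_comp fl (der_continuous dE).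
have F1 : expR (- (c * expR (- t))) / c @[t --> +oo] --> c^-1.
  have := cvg_exp (fun t => expR (- t)) 0 (@cvgr_expR R).
  by rewrite mulr0 oppr0 expR0 mul1r.
have F2 : - (expR (- (c * expR t)) / c) @[t --> +oo] --> (0 : R).
  rewrite -oppr0; apply: cvgN; rewrite -(mul0r c^-1); apply: cvgMl.
  have := @kernN_cvg0 R 0 c c0.
  by under eq_fun do rewrite kernN mul0r sub0r.
rewrite Rintegral_kern_diff1//.
rewrite (Rintegral_ge0_derivative dF (@continuous_kern _ 1 c) _ F1); last first.
  by move=> x _; exact: ltW (kern_gt0 _ _ _).
rewrite (Rintegral_ge0_derivative dFN (@continuous_kernN _ 1 c) _ F2); last first.
  by move=> x _; exact: ltW (kern_gt0 _ _ _).
rewrite oppr0 expR0 mulr1 expRN e2; field.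
by rewrite gt_eqF.
Qed.

(** For [a = y + e] with [e = 1 - ln 2], the substitutions by the gaps turn
    the integrand into [expR (- (y * level t))] times a function [B] that does
    not depend on [y] and changes sign once, from positive to negative.
    Increasing [y] puts more weight on small [t], hence increases the
    integral relative to its value 0 at [a = 1]. *)
Lemma gamma_median_linear_bound a : 1 <= a ->
  0 <= \int[mu]_(t in halfline) (1 * kern_diff a (a - 1 + ln 2) t).
Proof.
have c0 : 0 < ln 2 :> R by rewrite ln_gt0// ltr1n.
have c1 := @ln2_lt1 R.
have base := integral_kern_diff_exponential.
set c : R := ln 2 in c0 c1 base *.
rewrite le_eqVlt => /predU1P[<-|a1]; first by rewrite subrr add0r base.
pose e := 1 - c; pose y := a - 1 + c.
have y0 : 0 < y by rewrite /y; lra.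
have yc : 0 < y - c by rewrite /y; lra.
have a0 : 0 < a by lra.
pose B t := expR (- (e * lower_gap t)) * dlower_gap t -
  expR (e * upper_gap t) * (1 - dlower_gap t).
have upB : upcrossing (fun t => - B t).
  have up := upcrossing_exp_poly c1.
  pose w t := expR (- (e * lower_gap t)) * (expR t / (t * (expR t - 1))).
  apply: eq_upcrossing (upcrossing_mul (g := w) _ up) => t t0; last first.
    by rewrite /w mulr_gt0 ?expR_gt0// divr_gt0 ?expR_gt0// mulr_gt0// expR_sub1_gt0.
  have E0 := expR_sub1_gt0 t0.
  rewrite /w /B dupper_gapE// dlower_gapE// -/e.
  have -> : expR (e * upper_gap t) = expR (- (e * lower_gap t)) * expR (e * t).
    by rewrite -expRD /upper_gap; congr expR; ring.
  by rewrite (expRN t); field; rewrite !gt_eqF ?expR_gt0.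
have int_y z b : 0 < z -> 0 < b -> b - z = e ->
    mu.-integrable halfline (EFin \o (fun t => expR (- (z * level t)) * B t)) /\
    \int[mu]_(t in halfline) (1 * kern_diff b z t) =
    \int[mu]_(t in halfline) (expR (- (z * level t)) * B t).
  move=> z0 b0 bz; rewrite Rintegral_kern_diff1//.
  have [intl ->] := substitution_lower_gap (@continuous_kern _ b z)
    (fun t => ltW (kern_gt0 _ _ _)) (integrable_kern1 b0 z0).
  have [intu ->] := substitution_upper_gap (@continuous_kernN _ b z)
    (fun t => ltW (kern_gt0 _ _ _)) (integrable_kernN1 b z0).
  have BE t : t \in halfline -> kern b z (lower_gap t) * dlower_gap t -
      kern b z (- upper_gap t) * (1 - dlower_gap t) = expR (- (z * level t)) * B t.
    rewrite inE/= in_itv/= andbT => t0.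
    by rewrite kern_lower_gap kernN_upper_gap// bz /B; ring.
  split.
    have := integrableB measurable_halfline intl intu.
    apply: eq_integrable; first exact: measurable_halfline.
    by move=> t th; rewrite /= -EFinB BE.
  by rewrite -RintegralB//; exact: eq_Rintegral.
have [||| intc Ec] := int_y c 1; rewrite //.
have [||| inty Ey] := int_y y a; rewrite // ?/y ?/e; first by ring.
rewrite -/y Ey; move: base; rewrite Ec => I0.
have wE t : (1 - expR (- ((y - c) * level t))) * expR (- (c * level t)) * - B t =
    expR (- (y * level t)) * B t - 1 * (expR (- (c * level t)) * B t).
  rewrite (_ : expR (- (y * level t)) =
    expR (- ((y - c) * level t)) * expR (- (c * level t))); first by ring.
  by rewrite -expRD; congr expR; ring.
have [intw Ew] := Rintegral_comb 1 intc inty.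
have [intN EN] := Rintegral_comb 2 intc intc.
(* the difference of the integrals at [y] and at [c], with the sign change
   turned around by [- B] *)
have : 0 < \int[mu]_(t in halfline)
    ((1 - expR (- ((y - c) * level t))) * expR (- (c * level t)) * - B t).
  apply: (crossing_integral (w1 := fun t => expR (- (c * level t)))
    (rho := fun t => 1 - expR (- ((y - c) * level t))) upB) => //.
  - by move=> t _; exact: expR_gt0.
  - rewrite subr_ge0 expR_le1 oppr_le0 mulr_ge0 ?(ltW yc)//.
    rewrite /level /lower_gap invr0 mulr0 ln0// oppr0 expR0 add0r; exact: ler01.
  - move=> s t s0 st.
    by rewrite ltrD2l ltrN2 ltr_expR ltrN2 ltr_pM2l// level_increasing.
  - apply: eq_integrable intN; first exact: measurable_halfline.
    by move=> t _ /=; congr EFin; ring.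
  - apply: eq_integrable intw; first exact: measurable_halfline.
    by move=> t _ /=; rewrite wE.
  rewrite (_ : (fun t => _) = (fun t => expR (- (c * level t)) * B t -
    2 * (expR (- (c * level t)) * B t))); last by apply/funext => t; ring.
  by rewrite EN I0 mulr0 subr0.
under eq_Rintegral do rewrite wE.
by rewrite Ew I0 mulr0 subr0 => /ltW.
Qed.

End gamma_median.

(** * The variance-gamma density as a Gaussian mixture *)

Section mixture.
Context {R : realType}.
Notation mu := (@lebesgue_measure R).
Notation halfline := `](0 : R), +oo[%classic.

Lemma integral_fold (f : R -> R) : measurable_fun [set: R] f ->
  (forall t : R, 0 <= f t) ->
  (\int[mu]_t (f t)%:E = \int[mu]_(t in halfline) (f t + f (- t))%:E)%E.
Proof.
move=> mf f0.
have mfN : measurable_fun [set: R] (fun t => f (- t)).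
  by apply: measurableT_comp mf _; exact: oppr_measurable.
have mE (D : set (measurableTypeR R)) (g : R -> R) : measurable_fun [set: R] g ->
    measurable_fun D (fun t => (g t)%:E).
  by move=> mg; apply/measurable_EFinP; exact: measurable_funTS.
rewrite (_ : [set: R] = `]-oo, (0 : R)]%classic `|` halfline); last first.
  by rewrite -(set_itvNyy R) (@itv_bndbnd_setU _ _ _ (BRight (0 : R))).
rewrite ge0_integral_setU//; last 3 first.
- exact: mE.
- by move=> t _; rewrite lee_fin.
- apply/disj_setPS => t [] /=; rewrite !in_itv/= andbT => t0.
  by rewrite ltNge t0.
have := @ge0_integration_by_substitution0 R (fun t => (f (- t))%:E)
  (mE _ _ mfN) (fun t => f0 (- t)).
under [X in _ = X -> _]eq_integral do rewrite opprK.
move=> <-; rewrite -integral_itv_obnd_cbnd; last exact: mE.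
under [RHS]eq_integral do rewrite EFinD.
rewrite ge0_integralD//; first exact: addeC.
- by move=> t _; rewrite lee_fin.
- exact: mE.
- by move=> t _; rewrite lee_fin.
- exact: mE.
Qed.

Lemma integral_translation (G : R -> R) (c : R) : continuous G -> (forall t : R, 0 <= G t) ->
  (\int[mu]_t (G t)%:E = \int[mu]_t (G (t + c))%:E)%E.
Proof.
move=> cG G0; pose F (t : R) := t + c.
have dF (t : R) : is_derive t 1 F 1 by rewrite /F; der; ring.
have F'E : derive1 F = cst 1 by apply/funext => t; exact: der_derive1 (dF t).
rewrite (@increasing_ge0_integration_by_substitutionT R F G).
- by apply: eq_integral => t _; rewrite !fctE F'E mulr1.
- by move=> s t; rewrite ltrD2r.
- by rewrite F'E => t; exact: cvg_cst.
- by rewrite F'E; exact: is_cvg_cst.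
- by rewrite F'E; exact: is_cvg_cst.
- by move=> t; have [] := dF t.
- exact: cvg_addrr_Ny.
- exact: cvg_addrr.
- exact: cG.
- exact: G0.
Qed.

(** The integral over the whole line with [expR] in place of [cosh] is better
    suited to the substitution that follows. *)
Lemma besselK_integral (nu z : R) : 0 < z ->
  ((besselK nu z)%:E =
   (1 / 2)%:E * \int[mu]_u (expR (- (z * cosh u) - nu * u))%:E)%E.
Proof.
move=> z0; set H := fun u : R => expR (- (z * cosh u) - nu * u).
have cH : continuous H.
  move=> u; apply: (@der_continuous _ _ _ _); rewrite /H /cosh.
  repeat der_step.
have coshN (u : R) : cosh (- u) = cosh u by rewrite /cosh opprK addrC.
have HE u : expR (- (z * cosh u)) * cosh (nu * u) = 1 / 2 * (H u + H (- u)).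
  by rewrite /H coshN !expRD mulrN opprK {2}/cosh; field.
have cosh0 (u : R) : 0 < cosh u by rewrite divr_gt0// addr_gt0// expR_gt0.
have intf : mu.-integrable halfline
    (EFin \o (fun u => expR (- (z * cosh u)) * cosh (nu * u))).
  have z20 : 0 < z / 2 by rewrite divr_gt0.
  have [C C0 HC] := kernN_decay `|nu| z20.
  apply: (@integrable_exp_decay _ _ C 1) => //.
    apply: measurable_funTS; apply: continuous_measurable_fun => u.
    apply: (@der_continuous _ _ _ _); rewrite /cosh.
    repeat der_step.
  move=> u u0; rewrite mul1r ger0_norm ?mulr_ge0 ?expR_ge0// ?(ltW (cosh0 _))//.
  apply: le_trans (HC _ u0); rewrite kernN expRD mulrC.
  apply: ler_pM; rewrite ?expR_ge0// ?(ltW (cosh0 _))//.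
    have h1 : expR (nu * u) <= expR (`|nu| * u).
      by rewrite ler_expR ler_pM2r// ler_norm.
    have h2 : expR (- (nu * u)) <= expR (`|nu| * u).
      by rewrite ler_expR -mulNr ler_pM2r// -normrN ler_norm.
    by rewrite /cosh; lra.
  rewrite ler_expR /cosh; have := expR_gt0 (- u).
  by have := mulr_gt0 z0 (expR_gt0 (- u)); lra.
rewrite /besselK fineK; last first.
  by apply: integrable_fin_num intf; exact: measurable_halfline.
rewrite integral_fold; last 2 first.
- exact: continuous_measurable_fun.
- by move=> u; exact: expR_ge0.
rewrite -ge0_integralZl_EFin//.
- by apply: eq_integral => u _; rewrite HE EFinM.
apply/measurable_EFinP; apply: measurable_funTS; apply: measurable_funD.
  exact: continuous_measurable_fun.
by apply: measurableT_comp (continuous_measurable_fun cH) _; exact: oppr_measurable.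
Qed.

(** Up to a constant, the joint density at [(v, t)] of a variance-gamma
    variable [theta * S + sigma * Num.sqrt S * Z], where [Z] is a standard
    normal variable and [S], independent of [Z], has a gamma distribution of
    shape [a] and rate [1 / 2], and of the variable [t] that is defined by
    [S = 2 * y * expR (- t)]. *)
Definition mixture_kernel (a theta sigma y v t : R) : R :=
  gauss_fun ((v - theta * (2 * y * expR (- t))) / (2 * sigma * Num.sqrt y) *
             expR (t / 2)) *
  expR (- (y * expR (- t)) - (a - 1 / 2) * t).

Lemma mixture_kernel_ge0 (a theta sigma y v t : R) :
  0 <= mixture_kernel a theta sigma y v t.
Proof. by apply: mulr_ge0; [exact: gauss_fun_ge0|exact: expR_ge0]. Qed.

Lemma continuous_mixture_kernel (a theta sigma y v : R) :
  continuous (mixture_kernel a theta sigma y v).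
Proof.
move=> t; rewrite /mixture_kernel /gauss_fun.
eapply der_continuous; repeat der_step.
Qed.

(** Translating the variable of the Bessel integral by
    [ln (`|v| / (2 * y * k))], with [k] the root of
    [theta ^+ 2 + sigma ^+ 2], turns the exponent, after completion of the
    square, into that of the mixture. At [v = 0] the density is given a
    conventional value. *)
Lemma vg_pdf_mixture (r theta sigma y v : R) :
  0 < theta -> 0 < sigma -> 0 < y -> v != 0 ->
  ((vg_pdf r theta sigma v)%:E =
   ((sigma * Num.sqrt pi * gamma_fun (r / 2))^-1 * y `^ ((r - 1) / 2) / 2)%:E *
   \int[mu]_t (mixture_kernel (r / 2) theta sigma y v t)%:E)%E.
Proof.
move=> th0 s0 y0 v0.
set c := (sigma * _ * _)^-1; set nu := (r - 1) / 2.
set k := Num.sqrt (theta ^+ 2 + sigma ^+ 2).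
have ts0 : 0 < theta ^+ 2 + sigma ^+ 2 by rewrite addr_gt0 ?exprn_gt0.
have k0 : 0 < k by rewrite sqrtr_gt0.
have k2 : k ^+ 2 = theta ^+ 2 + sigma ^+ 2 by rewrite sqr_sqrtr// ltW.
have av0 : 0 < `|v| by rewrite normr_gt0.
have z0 : 0 < k / sigma ^+ 2 * `|v| by rewrite !mulr_gt0// invr_gt0 exprn_gt0.
rewrite /vg_pdf -/c -/k -/nu EFinM besselK_integral//.
pose b := ln (`|v| / (2 * y * k)).
have yk0 : 0 < 2 * y * k by rewrite !mulr_gt0.
have eb : expR b = `|v| / (2 * y * k) by rewrite lnK// posrE divr_gt0.
set H := fun u : R => expR (- (k / sigma ^+ 2 * `|v| * cosh u) - nu * u).
have cH : continuous H.
  move=> u; apply: (@der_continuous _ _ _ _); rewrite /H /cosh.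
  repeat der_step.
rewrite (integral_translation b cH (fun u => expR_ge0 _)).
have HE t : c * expR (theta * v / sigma ^+ 2) * (`|v| / (2 * k)) `^ nu * (1 / 2) *
    H (t + b) = c * y `^ nu / 2 * mixture_kernel (r / 2) theta sigma y v t.
  have vk0 : 0 < `|v| / (2 * k) by rewrite divr_gt0// mulr_gt0.
  rewrite /powR !gt_eqF//.
  have lnv : ln (`|v| / (2 * k)) = b + ln y.
    rewrite /b -lnM ?posrE ?divr_gt0//; congr ln; field.
    by rewrite !gt_eqF.
  rewrite [LHS](_ : _ = c / 2 * (expR (theta * v / sigma ^+ 2) *
    expR (nu * ln (`|v| / (2 * k))) * H (t + b))); last by field.
  rewrite [RHS](_ : _ = c / 2 * (expR (nu * ln y) *
    mixture_kernel (r / 2) theta sigma y v t)); last by field.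
  congr (_ * _); rewrite /H /mixture_kernel /gauss_fun -!expRD lnv; congr expR.
  have -> : cosh (t + b) = (expR t * (`|v| / (2 * y * k)) +
      expR (- t) * ((2 * y * k) / `|v|)) / 2.
    by rewrite /cosh opprD !expRD (expRN b) eb invf_div.
  have vv : `|v| ^+ 2 = v ^+ 2 by rewrite real_normK// num_real.
  rewrite (_ : k / sigma ^+ 2 * `|v| * _ =
    (v ^+ 2 * expR t / (2 * y) + 2 * y * k ^+ 2 * expR (- t)) / (2 * sigma ^+ 2)); last first.
    by rewrite -vv; field; rewrite !gt_eqF.
  have et2 : expR (t / 2) ^+ 2 = expR t by rewrite -expRM_natl; congr expR; field.
  have sy2 : Num.sqrt y ^+ 2 = y by rewrite sqr_sqrtr// ltW.
  rewrite k2 /nu exprMn et2 exprMn exprVn exprMn sy2 (expRN t); field.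
  by rewrite !gt_eqF ?expR_gt0.
have gf0 : 0 <= gamma_fun (r / 2).
  by apply: Rintegral_ge0 => x _; rewrite mulr_ge0 ?powR_ge0 ?expR_ge0.
have c0 : 0 <= c by rewrite invr_ge0 !mulr_ge0 ?sqrtr_ge0// ltW.
rewrite muleA -EFinM -[LHS]ge0_integralZl_EFin//; last 3 first.
- by move=> t _; rewrite lee_fin expR_ge0.
- apply/measurable_EFinP; apply: continuous_measurable_fun => t.
  apply: (@continuous_comp _ _ _ (fun t => t + b) H); last exact: cH.
  exact: der_continuous (der_add (der_id t) (der_cst b t)).
- by rewrite !mulr_ge0 ?expR_ge0 ?powR_ge0.
rewrite -[RHS]ge0_integralZl_EFin//; last 3 first.
- by move=> t _; rewrite lee_fin mixture_kernel_ge0.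
- apply/measurable_EFinP; apply: continuous_measurable_fun.
  exact: continuous_mixture_kernel.
- by rewrite !mulr_ge0 ?powR_ge0.
by apply: eq_integral => t _; rewrite -!EFinM HE.
Qed.

End mixture.

(** * The variance-gamma distribution function *)

Section tonelli_domain.
Context {R : realType}.
Notation mu := (@lebesgue_measure R).

Lemma tonelli_domain (D : set (measurableTypeR R)) (K : R -> R -> R) : measurable D ->
  measurable_fun [set: measurableTypeR R * measurableTypeR R] (fun vt => K vt.1 vt.2) ->
  (forall v t, 0 <= K v t) ->
  (\int[mu]_(v in D) \int[mu]_t (K v t)%:E = \int[mu]_t \int[mu]_(v in D) (K v t)%:E)%E.
Proof.
move=> mD mK K0.
pose g (vt : measurableTypeR R * measurableTypeR R) := (\1_D vt.1 * K vt.1 vt.2)%:E.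
have mg : measurable_fun setT g.
  apply/measurable_EFinP; apply: measurable_funM => //.
  by apply: (measurableT_comp _ measurable_fst); exact: measurable_indic.
have g0 vt : (0 <= g vt)%E by rewrite lee_fin mulr_ge0 ?indicE.
have := fubini_tonelli (m1 := mu) (m2 := mu) g mg g0.
have -> : (\int[mu]_v \int[mu]_t g (v, t) =
           \int[mu]_(v in D) \int[mu]_t (K v t)%:E)%E.
  rewrite [RHS]integral_mkcond; apply: eq_integral => v _.
  rewrite patchE; case: ifPn => vD.
    by apply: eq_integral => t _; rewrite /g/= indicE vD mul1r.
  by rewrite integral0_eq// => t _; rewrite /g/= indicE (negbTE vD) mul0r.
move=> ->; apply: eq_integral => t _.
rewrite [RHS]integral_mkcond; apply: eq_integral => v _.
by rewrite patchE /g/= indicE; case: ifPn => vD; rewrite ?mul1r ?mul0r.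
Qed.

End tonelli_domain.

Section half_mass.
Context {R : realType}.

Lemma twice_sub1 (c m n o : R) : m - n = o -> c * m + c * n = 1 -> 2 * (c * m) - 1 = c * o.
Proof. by move=> <-; rewrite mulrBr; lra. Qed.

Lemma half_le (p : R) : (1 / 2 <= p) = (0 <= 2 * p - 1).
Proof. by apply/idP/idP => ?; lra. Qed.

Lemma lt_half_of_sum (p e : R) : 0 < e -> p + (p + e) = 1 -> p < 1 / 2.
Proof. lra. Qed.

Lemma half_mass_le (c m n : R) : 0 <= c -> c * m + c * n = 1 -> 1 / 2 <= c * m -> n <= m.
Proof.
rewrite le_eqVlt => /predU1P[<-|c0] E h; first by move: E; lra.
by rewrite -(ler_pM2l c0); lra.
Qed.

Lemma half_lt (p : R) : (1 / 2 < p) = (0 < 2 * p - 1).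
Proof. by apply/idP/idP => ?; lra. Qed.

End half_mass.

Section mixture_distribution.
Context {R : realType}.
Notation mu := (@lebesgue_measure R).
Notation halfline := `](0 : R), +oo[%classic.
Variables (r theta sigma y : R).
Hypotheses (r0 : 0 < r) (theta0 : 0 < theta) (sigma0 : 0 < sigma) (y0 : 0 < y).

Let a := r / 2.
Let l := theta * Num.sqrt y / sigma.
Let K := mixture_kernel a theta sigma y.
Let C1 := (sigma * Num.sqrt pi * gamma_fun (r / 2))^-1 * y `^ ((r - 1) / 2) / 2.

Let sy0 : 0 < Num.sqrt y. Proof. by rewrite sqrtr_gt0. Qed.
Let sy2 : Num.sqrt y ^+ 2 = y. Proof. by rewrite sqr_sqrtr// ltW. Qed.
Let l0 : 0 < l. Proof. by rewrite divr_gt0// mulr_gt0. Qed.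
Let a0 : 0 < a. Proof. by rewrite divr_gt0. Qed.

Lemma measurable_mixture_kernel :
  measurable_fun [set: measurableTypeR R * measurableTypeR R] (fun vt => K vt.1 vt.2).
Proof.
have me (g : measurableTypeR R * measurableTypeR R -> R) :
    measurable_fun setT g -> measurable_fun setT (fun z => expR (g z)).
  by move=> mg; exact: measurableT_comp (@measurable_expR R) mg.
have mN (g : measurableTypeR R * measurableTypeR R -> R) :
    measurable_fun setT g -> measurable_fun setT (fun z => - g z).
  by move=> mg; apply: (measurableT_comp _ mg); exact: oppr_measurable.
have m1 : measurable_fun [set: measurableTypeR R * measurableTypeR R]
  (fun z => z.1 : R) := measurable_fst.
have m2 : measurable_fun [set: measurableTypeR R * measurableTypeR R]
  (fun z => z.2 : R) := measurable_snd.
have mg (g : measurableTypeR R * measurableTypeR R -> R) :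
    measurable_fun setT g -> measurable_fun setT (fun z => gauss_fun (g z)).
  by move=> m; exact: measurableT_comp (@measurable_gauss_fun R) m.
have me2 : measurable_fun [set: measurableTypeR R * measurableTypeR R]
    (fun z => expR (- z.2)) by apply: (me (fun z => - z.2)); exact: (mN (fun z => z.2)).
rewrite /K /mixture_kernel; apply: measurable_funM.
  apply: mg; apply: measurable_funM; last by apply: me; exact: measurable_funM.
  apply: measurable_funM => //; apply: measurable_funD => //.
  apply: (mN (fun z => theta * (2 * y * expR (- z.2)))).
  by apply: measurable_funM => //; exact: measurable_funM.
apply: me; apply: measurable_funD.
  by apply: (mN (fun z => y * expR (- z.2))); exact: measurable_funM.
by apply: (mN (fun z => (a - 1 / 2) * z.2)); exact: measurable_funM.
Qed.

Lemma vg_integral (D : set (measurableTypeR R)) : measurable D ->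
  (\int[mu]_(v in D) (vg_pdf r theta sigma v)%:E =
   C1%:E * \int[mu]_t \int[mu]_(v in D) (K v t)%:E)%E.
Proof.
move=> mD.
have K0 v t : 0 <= K v t by exact: mixture_kernel_ge0.
have C10 : 0 <= C1.
  have gf0 : 0 <= gamma_fun (r / 2).
    by apply: Rintegral_ge0 => x _; rewrite mulr_ge0 ?powR_ge0 ?expR_ge0.
  by rewrite /C1 !mulr_ge0 ?invr_ge0 ?mulr_ge0 ?powR_ge0 ?sqrtr_ge0// ltW.
have mK := measurable_mixture_kernel.
pose f (vt : measurableTypeR R * measurableTypeR R) := (K vt.1 vt.2)%:E.
have mf : measurable_fun setT f by exact/measurable_EFinP.
have mF : measurable_fun setT (fun v => \int[mu]_t (K v t)%:E)%E.
  exact: (@measurable_fun_fubini_tonelli_F _ _ _ _ R mu f mf (fun _ => K0 _ _)).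
have mD0 : measurable (D `\ (0 : R)) by apply: measurableD => //; exact: measurable_set1.
have E v : v \in D `\ (0 : R) ->
    ((vg_pdf r theta sigma v)%:E = C1%:E * \int[mu]_t (K v t)%:E)%E.
  by rewrite inE => -[_ /eqP v0]; exact: vg_pdf_mixture.
rewrite -(@integral_setD1 _ _ 0)//; last first.
  apply: (eq_measurable_fun (fun v => C1%:E * \int[mu]_t (K v t)%:E)%E).
    by move=> v vD; rewrite -E.
  by apply: measurable_funeM; exact: measurable_funTS.
under eq_integral => v vD do rewrite E//.
rewrite integral_setD1//; last by apply: measurable_funeM; exact: measurable_funTS.
have F0 v : (0 <= \int[mu]_t (K v t)%:E)%E.
  by apply: integral_ge0 => t _; rewrite lee_fin.
transitivity (C1%:E * \int[mu]_(v in D) \int[mu]_t (K v t)%:E)%E.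
  apply: ge0_integralZl_EFin C10; [exact: mD|by move=> v _; exact: F0|].
  exact: measurable_funTS.
by rewrite (tonelli_domain mD mK).
Qed.

Let scale (t : R) : R := 2 * sigma * Num.sqrt y * expR (- (t / 2)).

Let scale0 t : 0 < scale t.
Proof. by rewrite !mulr_gt0// expR_gt0. Qed.

Let KE v t : K v t = gauss_fun ((v - theta * (2 * y * expR (- t))) / scale t) *
  expR (- (y * expR (- t)) - (a - 1 / 2) * t).
Proof.
have et : (expR (- (t / 2)))^-1 = expR (t / 2) by rewrite -expRN opprK.
by rewrite /K /mixture_kernel /scale (invfM (2 * sigma * _)) et !mulrA.
Qed.

Let scale_kern t : scale t * expR (- (y * expR (- t)) - (a - 1 / 2) * t) =
  2 * sigma * Num.sqrt y * kern a y t.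
Proof.
rewrite /scale -mulrA -expRD /kern; congr (_ * expR _).
by field.
Qed.

(** The conditional probability of a value below [2 * theta * y] is a Gaussian
    distribution function at a multiple of [delta t], an odd function of
    [t]. *)
Let standardize t : (2 * theta * y - theta * (2 * y * expR (- t))) / scale t = l * delta t.
Proof.
have et : expR (- t) = expR (- (t / 2)) ^+ 2 by rewrite -expRM_natl; congr expR; field.
rewrite /scale /l /delta et (expRN (t / 2)).
move: sy2 sy0; move: (Num.sqrt y) => q <- q0; field.
by rewrite !gt_eqF ?expR_gt0.
Qed.

Let affine (t v : R) : R := (v - theta * (2 * y * expR (- t))) / scale t.

Let der_affine (t v : R) : is_derive v 1 (affine t) (scale t)^-1.
Proof. by rewrite /affine; der; ring. Qed.

Let gauss_cdfE z : ((gauss_cdf z)%:E = \int[mu]_(q in `]-oo, z]) (gauss_fun q)%:E)%E.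
Proof.
rewrite /gauss_cdf fineK//; apply: integrable_fin_num => //.
exact: integrable_gauss_Iic.
Qed.

Let affine_derive1 t : derive1 (affine t) = cst (scale t)^-1.
Proof. by apply/funext => v; exact: der_derive1 (der_affine t v). Qed.

Let affine_increasing (t u v : R) : u < v -> affine t u < affine t v.
Proof. by move=> uv; rewrite /affine ltr_pM2r ?invr_gt0// ltrD2r. Qed.

Let affine_continuous (t v : R) : {for v, continuous (affine t)}.
Proof. exact: der_continuous (der_affine t v). Qed.

Let mixture_kernel_integral (D : set (measurableTypeR R)) t (G : R) : measurable D ->
  (\int[mu]_(v in D) (gauss_fun (affine t v) / scale t)%:E = G%:E)%E ->
  (\int[mu]_(v in D) (K v t)%:E = (2 * sigma * Num.sqrt y * (kern a y t * G))%:E)%E.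
Proof.
move=> mD HG.
have KE' v : K v t = 2 * sigma * Num.sqrt y * kern a y t * (gauss_fun (affine t v) / scale t).
  rewrite KE -scale_kern -/(affine t v); move: (gauss_fun _) (expR _) => g e.
  by field; rewrite gt_eqF.
under eq_integral do rewrite KE' EFinM.
rewrite [in RHS]mulrA [in RHS]EFinM -HG; apply: ge0_integralZl_EFin.
- exact: mD.
- by move=> v _; rewrite lee_fin divr_ge0 ?gauss_fun_ge0// ltW.
- apply/measurable_EFinP; apply: measurable_funTS; apply: continuous_measurable_fun => v.
  apply: cvgM; last exact: cvg_cst.
  apply: (@continuous_comp _ _ _ (affine t) gauss_fun).
    exact: affine_continuous.
  exact: continuous_gauss_fun.
- by rewrite !mulr_ge0 ?(ltW (kern_gt0 _ _ _))// ltW.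
Qed.

Let mixture_kernel_lower x t :
  (\int[mu]_(v in `]-oo, x]) (K v t)%:E =
   (2 * sigma * Num.sqrt y * (kern a y t * gauss_cdf (affine t x)))%:E)%E.
Proof.
apply: mixture_kernel_integral; first exact: measurable_itv.
rewrite gauss_cdfE.
rewrite (@increasing_ge0_integration_by_substitutionNy R (affine t) gauss_fun).
- by apply: eq_integral => v _; rewrite !fctE affine_derive1.
- by move=> u v _ _; exact: affine_increasing.
- by rewrite affine_derive1 => v _; exact: cvg_cst.
- by rewrite affine_derive1; exact: is_cvg_cst.
- by rewrite affine_derive1; exact: cvg_cst.
- split=> [v _|]; first by have [] := der_affine t v.
  by apply: cvg_at_left_filter; exact: affine_continuous.
- apply: gt0_cvgMlNy; first by rewrite invr_gt0.
  exact: cvg_addrr_Ny.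
- by apply: continuous_subspaceT => q; exact: continuous_gauss_fun.
- by move=> q _; exact: gauss_fun_ge0.
Qed.

Let mixture_kernel_upper x t :
  (\int[mu]_(v in `]x, +oo[) (K v t)%:E =
   (2 * sigma * Num.sqrt y * (kern a y t * gauss_cdf (- affine t x)))%:E)%E.
Proof.
apply: mixture_kernel_integral; first exact: measurable_itv.
rewrite integral_itv_obnd_cbnd; last first.
  apply/measurable_EFinP; apply: measurable_funTS; apply: continuous_measurable_fun => v.
  apply: cvgM; last exact: cvg_cst.
  apply: (@continuous_comp _ _ _ (affine t) gauss_fun).
    exact: affine_continuous.
  exact: continuous_gauss_fun.
rewrite gauss_cdfE ge0_integration_by_substitutionNy; last 2 first.
- by apply: continuous_subspaceT => q; exact: continuous_gauss_fun.
- by move=> q _; exact: gauss_fun_ge0.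
under [RHS]eq_integral do rewrite /= /gauss_fun sqrrN -/(gauss_fun _).
rewrite (@increasing_ge0_integration_by_substitutiony R (affine t) gauss_fun).
- by apply: eq_integral => v _; rewrite !fctE affine_derive1.
- by move=> u v _ _; exact: affine_increasing.
- by rewrite affine_derive1 => v _; exact: cvg_cst.
- by rewrite affine_derive1; exact: is_cvg_cst.
- by rewrite affine_derive1; exact: is_cvg_cst.
- split=> [v _|]; first by have [] := der_affine t v.
  by apply: cvg_at_right_filter; exact: affine_continuous.
- apply: gt0_cvgMly; first by rewrite invr_gt0.
  exact: cvg_addrr.
- by apply: continuous_subspaceT => q; exact: continuous_gauss_fun.
- by move=> q _; exact: gauss_fun_ge0.
Qed.

(** Up to one and the same constant, the mass below [2 * theta * y] for
    [s = 1], and above it for [s = - 1]; the pairing of [t] with [- t] makes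
    [odd_integral] appear in the difference. *)
Let mass (s : R) : R := \int[mu]_(t in halfline)
  (gauss_cdf (s * (l * delta t)) * kern a y t +
   gauss_cdf (- (s * (l * delta t))) * kern a y (- t)).

Let continuous_scaled_delta (s : R) : continuous (fun t => s * (l * delta t)).
Proof.
move=> t.
exact: der_continuous (der_mul (der_cst s t) (der_mul (der_cst l t) (der_delta t))).
Qed.

Let continuous_kern_cdf (g : R -> R) : continuous g ->
  continuous (fun t => kern a y t * gauss_cdf (g t)).
Proof.
move=> cg t; apply: cvgM; first exact: continuous_kern.
apply: (@continuous_comp _ _ _ g gauss_cdf); first exact: cg.
exact: der_continuous (der_gauss_cdf _).
Qed.

Let integrable_cdf_kern (s : R) :
  mu.-integrable halfline (EFin \o (fun t => gauss_cdf (s * (l * delta t)) * kern a y t)) /\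
  mu.-integrable halfline
    (EFin \o (fun t => gauss_cdf (s * (l * delta t)) * kern a y (- t))).
Proof.
have [M M0 HM] := @gauss_cdf_bounded R.
have mw : measurable_fun halfline (fun t => gauss_cdf (s * (l * delta t))).
  apply: measurable_funTS; apply: continuous_measurable_fun => t.
  apply: (@continuous_comp _ _ _ (fun t => s * (l * delta t)) gauss_cdf).
    exact: continuous_scaled_delta.
  exact: der_continuous (der_gauss_cdf _).
have wM t : 0 < t -> `|gauss_cdf (s * (l * delta t))| <= M * expR (0 * t).
  move=> _; rewrite mul0r expR0 mulr1 ger0_norm.
    by case/andP: (HM (s * (l * delta t))).
  by case/andP: (HM (s * (l * delta t))).
by split; [exact: (integrable_kern y0 a0 mw wM)|exact: (integrable_kernN a y0 mw wM)].
Qed.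

Let integral_cdf_kern (s : R) :
  (\int[mu]_t (kern a y t * gauss_cdf (s * (l * delta t)))%:E = (mass s)%:E)%E.
Proof.
have [int1 _] := integrable_cdf_kern s.
have [_ int2] := integrable_cdf_kern (- s).
have [M M0 HM] := @gauss_cdf_bounded R.
rewrite integral_fold; last 2 first.
- apply: continuous_measurable_fun; apply: continuous_kern_cdf.
  exact: continuous_scaled_delta.
- by move=> t; rewrite mulr_ge0 ?(ltW (kern_gt0 _ _ _))//; case/andP: (HM (s * (l * delta t))).
have dN t : delta (- t) = - delta t by rewrite /delta mulNr opprK opprB.
under eq_integral do rewrite dN !mulrN.
rewrite /mass fineK.
  by apply: eq_integral => t _; congr EFin; rewrite mulrC; congr (_ + _); rewrite mulrC.
apply: integrable_fin_num; first exact: measurable_halfline.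
have := integrableD measurable_halfline int1 int2.
apply: eq_integrable; first exact: measurable_halfline.
by move=> t _; rewrite /= -EFinD mulNr.
Qed.

Let mass_diff : mass 1 - mass (- 1) = odd_integral l a y.
Proof.
have [i1 i2] := integrable_cdf_kern 1; have [j1 j2] := integrable_cdf_kern (- 1).
have int_add (f g : R -> R) : mu.-integrable halfline (EFin \o f) ->
    mu.-integrable halfline (EFin \o g) ->
    mu.-integrable halfline (EFin \o (fun t => f t + g t)).
  move=> intf intg; have := integrableD measurable_halfline intf intg.
  by apply: eq_integrable; [exact: measurable_halfline|move=> t _; rewrite /= -EFinD].
have E1 s t : - (s * (l * delta t)) = - s * (l * delta t) by rewrite mulNr.
rewrite /mass; under eq_Rintegral do rewrite E1.
under [X in _ - X]eq_Rintegral do rewrite E1 opprK.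
rewrite -(RintegralB measurable_halfline (int_add _ _ i1 j2) (int_add _ _ j1 i2)).
by apply: eq_Rintegral => t _; rewrite /gauss_weight /kern_diff mulN1r mul1r; ring.
Qed.

Context d {T : measurableType d} {P : probability T R} (X : {RV P >-> R}).
Hypothesis vgX : VG_distributed X r theta sigma.

Let C := C1 * (2 * sigma * Num.sqrt y).

Let vg_distribution (D : set (measurableTypeR R)) (g : R -> R) : measurable D ->
  continuous g -> (forall t, \int[mu]_(v in D) (K v t)%:E =
    (2 * sigma * Num.sqrt y * (kern a y t * gauss_cdf (g t)))%:E)%E ->
  distribution P X D = (C%:E * \int[mu]_t (kern a y t * gauss_cdf (g t))%:E)%E.
Proof.
move=> mD cg HD; rewrite vgX// vg_integral//.
under eq_integral do rewrite HD EFinM.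
rewrite ge0_integralZl_EFin; first by rewrite muleA -EFinM.
- exact: measurableT.
- move=> t _; have [M _ HM] := @gauss_cdf_bounded R.
  by rewrite lee_fin mulr_ge0 ?(ltW (kern_gt0 _ _ _))//; case/andP: (HM (g t)).
- by apply/measurable_EFinP; apply: continuous_measurable_fun; exact: continuous_kern_cdf.
- by rewrite !mulr_ge0// ltW.
Qed.

Let vg_mass (D : set (measurableTypeR R)) (s : R) : measurable D ->
  (forall t, \int[mu]_(v in D) (K v t)%:E =
    (2 * sigma * Num.sqrt y * (kern a y t * gauss_cdf (s * (l * delta t))))%:E)%E ->
  distribution P X D = (C * mass s)%:E.
Proof.
move=> mD /(vg_distribution mD) ->; first by rewrite integral_cdf_kern -EFinM.
exact: continuous_scaled_delta.
Qed.

Let cdf_mass : cdf X (2 * theta * y) = (C * mass 1)%:E.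
Proof.
apply: vg_mass; first exact: measurable_itv.
by move=> t; rewrite mixture_kernel_lower /affine standardize mul1r.
Qed.

Let ccdf_mass : ccdf X (2 * theta * y) = (C * mass (- 1))%:E.
Proof.
apply: vg_mass; first exact: measurable_itv.
by move=> t; rewrite mixture_kernel_upper /affine standardize mulN1r.
Qed.

(** No value of the normalizing constants is computed: positivity follows from
    the total mass 1. *)
Let C_gt0 : 0 < C.
Proof.
have Cge0 : 0 <= C.
  have gf0 : 0 <= gamma_fun (r / 2).
    by apply: Rintegral_ge0 => x _; rewrite mulr_ge0 ?powR_ge0 ?expR_ge0.
  by rewrite /C /C1 !mulr_ge0 ?invr_ge0 ?mulr_ge0 ?powR_ge0 ?sqrtr_ge0// ltW.
have H : C * mass 1 + C * mass (- 1) = 1.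
  by have := cdf_ccdf_1 X (2 * theta * y); rewrite cdf_mass ccdf_mass -EFinD => -[].
rewrite lt_neqAle Cge0 andbT eq_sym; apply/negP => /eqP C0.
by move/eqP: H; rewrite -mulrDr C0 mul0r eq_sym oner_eq0.
Qed.

Let cdf_odd_integral :
  exists2 p, cdf X (2 * theta * y) = p%:E & 2 * p - 1 = C * odd_integral l a y.
Proof.
exists (C * mass 1); first exact: cdf_mass.
have H : C * mass 1 + C * mass (- 1) = 1.
  by have := cdf_ccdf_1 X (2 * theta * y); rewrite cdf_mass ccdf_mass -EFinD => -[].
exact: twice_sub1 mass_diff H.
Qed.

Lemma vg_cdf_ge_half : ((1 / 2)%:E <= cdf X (2 * theta * y))%E =
  (0 <= odd_integral (theta * Num.sqrt y / sigma) (r / 2) y).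
Proof.
have [p -> pE] := cdf_odd_integral.
by rewrite lee_fin half_le pE (pmulr_rge0 _ C_gt0).
Qed.

Lemma vg_cdf_gt_half : ((1 / 2)%:E < cdf X (2 * theta * y))%E =
  (0 < odd_integral (theta * Num.sqrt y / sigma) (r / 2) y).
Proof.
have [p -> pE] := cdf_odd_integral.
by rewrite lte_fin half_lt pE (pmulr_rgt0 _ C_gt0).
Qed.

(** Given the mixing variable, [X] is Gaussian with a positive mean. *)
Lemma vg_cdf0_lt_half : (cdf X 0 < (1 / 2)%:E)%E.
Proof.
have ca : continuous (fun t => affine t 0).
  move=> t; rewrite /affine /scale; eapply der_continuous; repeat der_step.
  by rewrite mulf_neq0 ?gt_eqF// ?mulr_gt0// expR_gt0.
have caN : continuous (fun t => - affine t 0) by move=> t; apply: cvgN; exact: ca.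
have Fl : cdf X 0 = (C%:E * \int[mu]_t (kern a y t * gauss_cdf (affine t 0))%:E)%E.
  by apply: vg_distribution.
have Fu : ccdf X 0 = (C%:E * \int[mu]_t (kern a y t * gauss_cdf (- affine t 0))%:E)%E.
  by apply: vg_distribution.
have aneg t : 0 < - affine t 0.
  by rewrite /affine sub0r mulNr opprK divr_gt0// !mulr_gt0// expR_gt0.
have g0 (z : R) : 0 <= gauss_cdf z.
  by have [M _ HM] := @gauss_cdf_bounded R; case/andP: (HM z).
pose w t := kern a y t * gauss_weight (- affine t 0).
have w0 t : 0 < w t by rewrite mulr_gt0 ?kern_gt0// gauss_weight_gt0.
have mw : measurable_fun [set: measurableTypeR R] w.
  apply: continuous_measurable_fun => t; apply: cvgM; first exact: continuous_kern.
  apply: (@continuous_comp _ _ _ (fun t => - affine t 0) gauss_weight); first exact: caN.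
  exact: der_continuous (der_gauss_weight _).
have E : ccdf X 0 = (cdf X 0 + C%:E * \int[mu]_t (w t)%:E)%E.
  rewrite Fl Fu -ge0_muleDr; last 2 first.
  - by apply: integral_ge0 => t _; rewrite lee_fin mulr_ge0 ?(ltW (kern_gt0 _ _ _)).
  - by apply: integral_ge0 => t _; rewrite lee_fin ltW.
  congr (_ * _)%E; rewrite -ge0_integralD//.
  - apply: eq_integral => t _; rewrite -EFinD /w /gauss_weight opprK; congr EFin; ring.
  - by move=> t _; rewrite lee_fin mulr_ge0 ?(ltW (kern_gt0 _ _ _)).
  - by apply/measurable_EFinP; apply: continuous_measurable_fun; exact: continuous_kern_cdf.
  - by move=> t _; rewrite lee_fin ltW.
  - exact/measurable_EFinP.
have wpos : (0 < C%:E * \int[mu]_t (w t)%:E)%E.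
  rewrite mule_gt0 ?lte_fin ?C_gt0//.
  by apply: (@integral_gt0 _ setT w 0 1) => // t _; exact: ltW.
have := cdf_ccdf_1 X 0; rewrite E; move: wpos.
have : cdf X 0 \is a fin_num by rewrite fin_num_measure.
case: (cdf X 0) => // p _; case: (C%:E * _)%E => // e.
rewrite !lte_fin -!EFinD => e0 -[]; exact: lt_half_of_sum.
Qed.

End mixture_distribution.

(** * Medians *)

Section median.
Context {R : realType} d {T : measurableType d} {P : probability T R}.
Variable X : {RV P >-> R}.

Let S := [set x : R | ((1 / 2)%:E <= cdf X x)%E].

Let half_lt1 : ((1 / 2)%:E < (1 : \bar R))%E.
Proof. by rewrite lte_fin; lra. Qed.

Let half_gt0 : ((0 : \bar R) < (1 / 2)%:E)%E.
Proof. by rewrite lte_fin; lra. Qed.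

Let S_nonempty : S !=set0.
Proof.
have /(_ _ (open_ereal_gt' half_lt1)) := @cvg_cdfy1 _ _ _ _ X.
move=> [M [_ HM]]; exists (M + 1); rewrite /S/=.
by apply: ltW; apply: HM; rewrite ltrDl.
Qed.

Let S_has_lbound : has_lbound S.
Proof.
have /(_ _ (open_ereal_lt' half_gt0)) := @cvg_cdfNy0 _ _ _ _ X.
move=> [M [_ HM]]; exists (M - 1) => x Sx; rewrite leNgt; apply/negP => xM.
have : (cdf X x < (1 / 2)%:E)%E by apply: HM; lra.
by rewrite ltNge => /negP; apply; exact: Sx.
Qed.

Lemma median_le x : ((1 / 2)%:E <= cdf X x)%E -> median X <= x.
Proof. by move=> Sx; exact: (ge_inf S_has_lbound). Qed.

(** By right continuity, the distribution function stays below [1 / 2] on some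
    interval to the right of [x]. *)
Lemma lt_median x : (cdf X x < (1 / 2)%:E)%E -> x < median X.
Proof.
move=> Fx; have Fz : \forall z \near x^'+, (cdf X z < (1 / 2)%:E)%E.
  exact: (@cdf_right_continuous _ _ _ _ X x _ (open_ereal_lt' Fx)).
near x^'+ => z.
have xz : x < z by near: z; exact: nbhs_right_gt.
have Fzh : (cdf X z < (1 / 2)%:E)%E by near: z; exact: Fz.
apply: (lt_le_trans xz); apply: (lb_le_inf S_nonempty) => u Su.
rewrite leNgt; apply/negP => uz; have := le_lt_trans (cdf_nondecreasing X (ltW uz)) Fzh.
by rewrite ltNge => /negP; apply; exact: Su.
Unshelve. all: by end_near. Qed.

Lemma cdf_median_ge_half : ((1 / 2)%:E <= cdf X (median X))%E.
Proof. by rewrite leNgt; apply/negP => /lt_median; rewrite ltxx. Qed.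

(** Without an atom at [x] the distribution function is left-continuous
    there. *)
Lemma median_lt x : (distribution P X [set x] = 0)%E ->
  ((1 / 2)%:E < cdf X x)%E -> median X < x.
Proof.
move=> Px0 Fx; rewrite ltNge; apply/negP => xm.
pose F n : set R := `]-oo, x - n.+1%:R^-1]%classic.
have Fn n : (distribution P X (F n) <= (1 / 2)%:E)%E.
  rewrite leNgt; apply/negP => /ltW /median_le; apply/negP; rewrite -ltNge.
  by apply: lt_le_trans xm; rewrite ltrBlDr ltrDl invr_gt0.
have bigF : \bigcup_n F n = `]-oo, x[%classic.
  apply/seteqP; split => z /=.
    move=> [n _]; rewrite /F/= !in_itv/= => /le_lt_trans; apply.
    by rewrite ltrBlDr ltrDl invr_gt0.
  rewrite in_itv/= => zx; exists (Num.truncn (x - z)^-1) => //=.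
  rewrite /F/= in_itv/= lerBrDr -lerBrDl invf_ple ?posrE ?subr_gt0//.
  by rewrite ltW// truncnS_gt.
have mF n : measurable (F n : set (measurableTypeR R)) by exact: measurable_itv.
have cvgF : distribution P X (F n) @[n --> \oo] --> distribution P X (\bigcup_n F n).
  apply: nondecreasing_cvg_mu => //.
    by apply: bigcup_measurable => n _; exact: mF.
  move=> m n mn; rewrite subsetEset; apply: subset_itvl; rewrite bnd_simp lerD2l lerN2.
  by rewrite lef_pV2 ?posrE// ler_nat.
have lim : (distribution P X (\bigcup_n F n) <= (1 / 2)%:E)%E.
  by apply: (cvge_le _ cvgF); apply: nearW.
move: Fx; rewrite ltNge => /negP; apply.
rewrite /cdf (_ : `]-oo, x]%classic = `]-oo, x[%classic `|` [set x]); last first.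
  by rewrite setUitv1.
rewrite measureU//; last first.
  by apply/seteqP; split => // z [/=]; rewrite in_itv/= => + zx; rewrite zx ltxx.
by rewrite [X in (_ + X)%E]Px0 adde0 -bigF.
Qed.

End median.

(** * The gamma distribution function *)

Section reflection.
Context {R : realType}.
Notation mu := (@lebesgue_measure R).

Lemma integral_reflection (f : R -> R) (x : R) : measurable_fun `]0, x[ f ->
  (forall s : R, 0 <= f s) ->
  (\int[mu]_(s in `]0%R, x[) (f s)%:E = \int[mu]_(s in `](- x)%R, 0%R[) (f (- s))%:E)%E.
Proof.
move=> mf f_ge0.
have mI : measurable (`]0, x[%classic : set (measurableTypeR R)) by exact: measurable_itv.
have mfp : measurable_fun [set: R] (fun s => ((f \_ `]0, x[) s)%:E).
  by apply/measurable_EFinP; exact/(measurable_restrictT _ mI).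
have fp0 s : (0 <= ((f \_ `]0, x[) s)%:E)%E.
  by rewrite lee_fin patchE; case: ifP.
have := ge0_integration_by_substitution0 mfp fp0.
rewrite [X in X = _ -> _](_ : _ = \int[mu]_(s in `]0%R, x[) (f s)%:E)%E => [->|].
  rewrite [RHS]integral_mkcond [LHS]integral_mkcond; apply: eq_integral => s _.
  rewrite !patchE !mem_setE !in_itv/= oppr_gt0 (ltrNl s x).
  case: (ltrP s 0) => s0; first by rewrite (ltW s0)/= andbT; case: ifP.
  by rewrite andbF/=; case: ifP.
rewrite integral_mkcond [RHS]integral_mkcond; apply: eq_integral => s _.
rewrite !patchE !mem_setE !in_itv/= andbT.
by case: (ltrP 0 s) => s0; [rewrite (ltW s0) /=; case: ifP|rewrite /=; case: ifP].
Qed.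

End reflection.

Section gamma_cdf.
Context {R : realType}.
Notation mu := (@lebesgue_measure R).
Notation halfline := `](0 : R), +oo[%classic.
Variables (a theta y : R).
Hypotheses (a0 : 0 < a) (theta0 : 0 < theta) (y0 : 0 < y).

Let lambda := (2 * theta)^-1.
Let x := 2 * theta * y.
Let c := lambda `^ a / gamma_fun a.
Let f (s : R) : R := s `^ (a - 1) * expR (- (lambda * s)).

Let x0 : 0 < x. Proof. by rewrite !mulr_gt0. Qed.
Let lx : lambda * x = y.
Proof. by rewrite /lambda /x mulKf// mulf_neq0// gt_eqF. Qed.

Let f_exp s : 0 < s -> f s * s = expR (a * ln s - lambda * s).
Proof.
move=> s0; rewrite /f /powR gt_eqF//.
have -> : expR (a * ln s - lambda * s) =
    expR ((a - 1) * ln s) * expR (ln s) * expR (- (lambda * s)).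
  by rewrite -!expRD; congr expR; ring.
by rewrite lnK ?posrE// mulrAC.
Qed.

Let f_cont s : 0 < s -> {for s, continuous f}.
Proof.
move=> s0.
have : {for s, continuous (fun s => expR ((a - 1) * ln s) * expR (- (lambda * s)))}.
  by eapply der_continuous; repeat der_step; exact: s0.
have fE z : 0 < z -> f z = expR ((a - 1) * ln z) * expR (- (lambda * z)).
  by move=> z0; rewrite /f /powR gt_eqF.
move=> h; rewrite /prop_for /continuous_at fE//; apply: cvg_trans h.
apply: near_eq_cvg; near=> z; rewrite fE//.
by near: z; exact: lt_nbhsr.
Unshelve. all: by end_near. Qed.

Let f_ge0 s : 0 <= f s. Proof. by rewrite mulr_ge0 ?powR_ge0 ?expR_ge0. Qed.

Let upper : (\int[mu]_(s in `]x, +oo[) (f s)%:E =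
  \int[mu]_(t in halfline) (x `^ a * kern a y (- t))%:E)%E.
Proof.
rewrite (@substitution_increasing _ `]x, +oo[ (fun t => x * expR t) (fun t => x * expR t) f).
- apply: eq_integral => t; rewrite inE/= in_itv/= andbT => t0; congr EFin.
  have xt0 : 0 < x * expR t by rewrite mulr_gt0// expR_gt0.
  rewrite f_exp// kernN /powR gt_eqF// lnM ?posrE ?expR_gt0// expRK -expRD.
  by congr expR; rewrite -lx; ring.
- exact: interval_is_interval.
- by move=> t _; rewrite mulr_gt0// expR_gt0.
- by move=> t _; eapply der_continuous; repeat der_step.
- by move=> t t0; rewrite /= in_itv/= andbT ltr_pMr// expR_gt1.
- move=> s /=; rewrite in_itv/= andbT => xs.
  have s0 : 0 < s / x by rewrite divr_gt0// (lt_trans x0).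
  have ls0 : 0 < ln (s / x) by rewrite ln_gt0// ltr_pdivlMr// mul1r.
  exists (ln (s / x)), (ln (s / x)); split => //; rewrite lnK ?posrE//.
    by rewrite mulrCA divff ?mulr1// gt_eqF.
  by rewrite mulrCA divff ?mulr1// gt_eqF.
- by move=> s /=; rewrite in_itv/= andbT => /(lt_trans x0)/f_cont.
- by move=> s _; exact: f_ge0.
Qed.

Let mf0x : measurable_fun `]0, x[ f.
Proof.
apply: open_continuous_measurable_fun; first exact: interval_open.
by move=> s; rewrite inE/= in_itv/= => /andP[s0 _]; exact: f_cont.
Qed.

Let lower : (\int[mu]_(s in `]0%R, x[) (f s)%:E =
  \int[mu]_(t in halfline) (x `^ a * kern a y t)%:E)%E.
Proof.
rewrite (integral_reflection mf0x f_ge0).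
have dF (t : R) : 0 < t -> is_derive t 1 (fun t => - (x * expR (- t))) (x * expR (- t)).
  by move=> _; der; ring.
rewrite (@substitution_increasing _ `]- x, 0[ _ _ (fun s => f (- s))
  (@interval_is_interval _ _) dF).
- apply: eq_integral => t; rewrite inE/= in_itv/= andbT => t0; congr EFin.
  have xt0 : 0 < x * expR (- t) by rewrite mulr_gt0// expR_gt0.
  rewrite opprK f_exp// /kern /powR gt_eqF// lnM ?posrE ?expR_gt0// expRK -expRD.
  by congr expR; rewrite -lx; ring.
- by move=> t _; rewrite mulr_gt0// expR_gt0.
- by move=> t _; eapply der_continuous; repeat der_step.
- move=> t t0; rewrite /= in_itv/= oppr_lt0 mulr_gt0 ?expR_gt0// andbT ltrN2.
  by rewrite gtr_pMr// expR_lt1 oppr_lt0.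
- move=> s /=; rewrite in_itv/= => /andP[xs s0].
  have sx0 : 0 < x / - s by rewrite divr_gt0// oppr_gt0.
  have ls0 : 0 < ln (x / - s).
    by rewrite ln_gt0// ltr_pdivlMr ?oppr_gt0// mul1r ltrNl.
  have E : - (x * expR (- ln (x / - s))) = s.
    by rewrite expRN lnK ?posrE// invf_div mulrCA divff ?mulr1 ?opprK// gt_eqF.
  by exists (ln (x / - s)), (ln (x / - s)); rewrite E.
- move=> s /=; rewrite in_itv/= => /andP[_ s0].
  apply: (@continuous_comp _ _ _ -%R f); first exact: opp_continuous.
  by apply: f_cont; rewrite oppr_gt0.
- by move=> s _; exact: f_ge0.
Qed.

Context d {T : measurableType d} {P : probability T R} (G : {RV P >-> R}).
Hypothesis gammaG : gamma_distributed G a lambda.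

Let c_ge0 : 0 <= c.
Proof.
rewrite divr_ge0 ?powR_ge0//; apply: Rintegral_ge0 => z _.
by rewrite mulr_ge0 ?powR_ge0 ?expR_ge0.
Qed.

Let pdfE s : 0 < s -> gamma_pdf a lambda s = c * f s.
Proof. by move=> s0; rewrite /gamma_pdf s0 /c /f !mulrA. Qed.

Lemma gamma_cdf0 : cdf G 0 = 0%E.
Proof.
rewrite /cdf gammaG; last exact: measurable_itv.
apply: integral0_eq => s /=; rewrite in_itv/= => s0.
by rewrite /gamma_pdf ltNge s0.
Qed.

Let finE (g : R -> R) : mu.-integrable halfline (EFin \o g) ->
  (\int[mu]_(t in halfline) (x `^ a * g t)%:E =
   (x `^ a * \int[mu]_(t in halfline) g t)%:E)%E.
Proof.
move=> intg; under eq_integral do rewrite EFinM.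
rewrite integralZl//.
by rewrite EFinM fineK//; exact: (integrable_fin_num measurable_halfline intg).
Qed.

Let pdf_integral (D : set (measurableTypeR R)) : measurable D ->
  (forall s, D s -> 0 < s) ->
  (\int[mu]_(s in D) (gamma_pdf a lambda s)%:E = c%:E * \int[mu]_(s in D) (f s)%:E)%E.
Proof.
move=> mD D0; rewrite -ge0_integralZl_EFin//.
- by apply: eq_integral => s; rewrite inE => /D0/pdfE ->.
- by move=> s _; rewrite lee_fin f_ge0.
apply/measurable_EFinP; apply: (measurable_funS (E := halfline)).
- exact: measurable_halfline.
- by move=> s /D0 s0; rewrite /= in_itv/= s0.
apply: open_continuous_measurable_fun; first exact: interval_open.
by move=> s; rewrite inE/= in_itv/= andbT; exact: f_cont.
Qed.

Let cdfE : cdf G x = (c * (x `^ a * \int[mu]_(t in halfline) kern a y t))%:E.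
Proof.
rewrite /cdf gammaG; last exact: measurable_itv.
have mE : measurable_fun `]0, x[ (EFin \o f) by exact/measurable_EFinP.
rewrite EFinM -(finE (integrable_kern1 a0 y0)) -lower (integral_itv_bndo_bndc mE).
rewrite -pdf_integral; last 2 first.
- exact: measurable_itv.
- by move=> s /=; rewrite in_itv/= => /andP[].
rewrite integral_mkcond [RHS]integral_mkcond; apply: eq_integral => s _.
rewrite !patchE !mem_setE !in_itv/=; case: ltP => s0 //=.
by case: ifP => // _; rewrite /gamma_pdf ltNge s0.
Qed.

Let ccdfE : ccdf G x = (c * (x `^ a * \int[mu]_(t in halfline) kern a y (- t)))%:E.
Proof.
rewrite /ccdf gammaG; last exact: measurable_itv.
rewrite EFinM -(finE (integrable_kernN1 a y0)) -upper.
apply: pdf_integral; first exact: measurable_itv.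
by move=> s /=; rewrite in_itv/= andbT; exact: lt_trans.
Qed.

(** The substitutions [x * expR t] and [x * expR (- t)] turn the masses above
    and below [x = 2 * theta * y] into the integrals of the two halves of
    [kern_diff]. *)
Lemma gamma_cdf_ge_half : ((1 / 2)%:E <= cdf G x)%E ->
  0 <= \int[mu]_(t in halfline) (1 * kern_diff a y t).
Proof.
have E : (cdf G x + ccdf G x = 1)%E := cdf_ccdf_1 G x.
move: E; rewrite ccdfE cdfE lee_fin -EFinD => -[E] h.
rewrite (Rintegral_kern_diff1 a0 y0) subr_ge0.
have := half_mass_le c_ge0 E h.
by rewrite ler_pM2l// powR_gt0.
Qed.

End gamma_cdf.

(** * The median of the variance-gamma distribution *)

Section variance_gamma_median.
Context {R : realType}.
Notation mu := (@lebesgue_measure R).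
Notation halfline := `](0 : R), +oo[%classic.
Variables (r theta : R).
Hypotheses (r0 : 0 < r) (theta0 : 0 < theta).

Let a0 : 0 < r / 2. Proof. by rewrite divr_gt0. Qed.

Let rate (sigma y : R) : R := theta * Num.sqrt y / sigma.

Let rate_gt0 (sigma y : R) : 0 < sigma -> 0 < y -> 0 < rate sigma y.
Proof. by move=> s0 y0; rewrite divr_gt0// mulr_gt0// sqrtr_gt0. Qed.

Section one_variable.
Context (sigma : R) d {T : measurableType d} {P : probability T R} (X : {RV P >-> R}).
Hypotheses (sigma0 : 0 < sigma) (vgX : VG_distributed X r theta sigma).

Lemma vg_median_gt0 : 0 < median X.
Proof. by apply: lt_median; exact: (vg_cdf0_lt_half r0 theta0 sigma0 (@ltr01 R) vgX). Qed.

Lemma vg_median_lt (y : R) : 0 < y ->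
  0 < odd_integral (rate sigma y) (r / 2) y -> median X < 2 * theta * y.
Proof.
move=> y0 o0; apply: median_lt; last by rewrite (vg_cdf_gt_half r0 theta0 sigma0 y0 vgX).
by rewrite vgX ?integral_set1//; exact: measurable_set1.
Qed.

Lemma vg_median_lt_of_gamma (y : R) : 0 < y ->
  0 <= \int[mu]_(t in halfline) (1 * kern_diff (r / 2) y t) ->
  median X < 2 * theta * y.
Proof.
move=> y0 I0; apply: vg_median_lt => //.
by apply: odd_integral_gt0_of_cst => //; exact: rate_gt0.
Qed.

Lemma vg_median_odd_integral :
  0 <= odd_integral (rate sigma (median X / (2 * theta))) (r / 2)
    (median X / (2 * theta)).
Proof.
have y0 : 0 < median X / (2 * theta) by rewrite divr_gt0 ?vg_median_gt0// mulr_gt0.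
rewrite -(vg_cdf_ge_half r0 theta0 sigma0 y0 vgX).
rewrite [X in cdf _ X](_ : _ = median X); first exact: cdf_median_ge_half.
by rewrite mulrC divfK// mulf_neq0// gt_eqF.
Qed.

(** At [y = r / 2 - 1 / 2] the odd integral is negative for every [sigma]. *)
Lemma vg_median_gt : 1 < r -> (r - 1) * theta < median X.
Proof.
move=> r1; pose y := r / 2 - 1 / 2.
have y0 : 0 < y by rewrite /y; lra.
have -> : (r - 1) * theta = 2 * theta * y by rewrite /y; field.
apply: lt_median; rewrite ltNge (vg_cdf_ge_half r0 theta0 sigma0 y0 vgX) -ltNge.
apply: odd_integral_critical_lt0; first exact: rate_gt0.
by lra.
Qed.

End one_variable.

(** At [2 * theta * y] equal to the first median, the odd integral is
    nonnegative for [sigma1], hence positive for [sigma2]. *)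
Lemma vg_median_decreasing (sigma1 sigma2 : R)
    d1 (T1 : measurableType d1) (P1 : probability T1 R) (X1 : {RV P1 >-> R})
    d2 (T2 : measurableType d2) (P2 : probability T2 R) (X2 : {RV P2 >-> R}) :
  0 < sigma1 -> sigma1 < sigma2 ->
  VG_distributed X1 r theta sigma1 -> VG_distributed X2 r theta sigma2 ->
  median X2 < median X1.
Proof.
move=> s1 s12 vg1 vg2; have s2 : 0 < sigma2 by exact: lt_trans s12.
have o1 := vg_median_odd_integral s1 vg1.
have m1 := vg_median_gt0 s1 vg1.
set y := median X1 / (2 * theta) in o1.
have y0 : 0 < y by rewrite divr_gt0// mulr_gt0.
have -> : median X1 = 2 * theta * y by rewrite /y mulrC divfK// mulf_neq0// gt_eqF.
apply: (vg_median_lt s2 vg2 y0); apply: odd_integral_gt0_of_larger o1 => //.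
- exact: rate_gt0.
- by rewrite /rate ltr_pM2l ?mulr_gt0 ?sqrtr_gt0// ltf_pV2 ?posrE.
Qed.

Lemma vg_median_lt_gamma_median (sigma : R)
    d1 (T1 : measurableType d1) (P1 : probability T1 R) (X : {RV P1 >-> R})
    d2 (T2 : measurableType d2) (P2 : probability T2 R) (G : {RV P2 >-> R}) :
  0 < sigma -> VG_distributed X r theta sigma ->
  gamma_distributed G (r / 2) (2 * theta)^-1 -> median X < median G.
Proof.
move=> s0 vgX gG.
have m0 : 0 < median G.
  by apply: lt_median; rewrite (gamma_cdf0 gG) lte_fin; lra.
pose y := median G / (2 * theta).
have y0 : 0 < y by rewrite divr_gt0// mulr_gt0.
have mE : median G = 2 * theta * y by rewrite /y mulrC divfK// mulf_neq0// gt_eqF.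
rewrite mE; apply: (vg_median_lt_of_gamma s0 vgX y0).
apply: (gamma_cdf_ge_half a0 theta0 y0 gG); rewrite -mE.
exact: cdf_median_ge_half.
Qed.

(** The rate [theta * Num.sqrt y / sigma] takes every positive value, so that
    [sigma] can be read off from the rate given by
    [odd_integral_eventually_gt0]. *)
Lemma vg_median_eventually_lt (m : R) : 0 < m -> (r - 1) * theta < m ->
  exists2 sigma, 0 < sigma & forall d (T : measurableType d) (P : probability T R)
    (X : {RV P >-> R}), VG_distributed X r theta sigma -> median X < m.
Proof.
move=> m0 rm; pose y := m / (2 * theta).
have y0 : 0 < y by rewrite divr_gt0// mulr_gt0.
have mE : m = 2 * theta * y by rewrite /y mulrC divfK// mulf_neq0// gt_eqF.
have ay : r / 2 - 1 / 2 < y by rewrite /y ltr_pdivlMr ?mulr_gt0//; lra.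
have [l l0 ol] := odd_integral_eventually_gt0 a0 y0 ay.
have s0 : 0 < theta * Num.sqrt y / l by rewrite divr_gt0// mulr_gt0// sqrtr_gt0.
exists (theta * Num.sqrt y / l) => // d T P X vgX; rewrite mE.
apply: (vg_median_lt s0 vgX y0).
rewrite (_ : rate _ y = l)// /rate; field.
by rewrite !gt_eqF ?sqrtr_gt0.
Qed.

End variance_gamma_median.

Lemma expRN_lt_quadratic (R : realType) (x : R) : 0 < x ->
  expR (- x) < 1 - x + x ^+ 2 / 2.
Proof.
move=> x0; rewrite -subr_gt0; pose f (t : R) := 1 - t + t ^+ 2 / 2 - expR (- t).
have -> : 0 = f 0 by rewrite /f oppr0 expR0; field.
apply: (@derivative_gt0_increasing _ f (fun t => t - 1 + expR (- t))) => //.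
  by move=> t _; rewrite /f; der; field.
move=> t /andP[t0 _]; have := @expR_gt1Dx R (- t).
by rewrite oppr_eq0 gt_eqF// => /(_ isT); lra.
Qed.

Theorem corollary2p3 (R : realType) (r theta : R)
    (hr : 0 < r) (htheta : 0 < theta)
    (d : R -> measure_display)
    (Omega : forall sigma : R, measurableType (d sigma))
    (P : forall sigma : R, probability (Omega sigma) R)
    (V : forall sigma : R, {RV (P sigma) >-> R})
    (hV : forall sigma : R, 0 < sigma ->
      VG_distributed (V sigma) r theta sigma) :
  [/\ (forall sigma1 sigma2 : R, 0 < sigma1 -> sigma1 < sigma2 ->
         median (V sigma2) < median (V sigma1)),
      (forall (d' : measure_display) (Omega' : measurableType d')
           (P' : probability Omega' R) (G : {RV P' >-> R}),
         gamma_distributed G (r / 2) (2 * theta)^-1 ->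
         forall sigma : R, 0 < sigma -> median (V sigma) < median G),
      median (V sigma) @[sigma --> +oo] -->
        (if 1 < r then (r - 1) * theta else 0),
      (forall sigma : R, 0 < sigma ->
         [/\ Num.max 0 ((r - 1) * theta) < median (V sigma),
             median (V sigma) < r * theta * expR (- (2 / (3 * r))) &
             r * theta * expR (- (2 / (3 * r)))
               < (r - 2 / 3 + 2 / (9 * r)) * theta]) &
      (2 <= r -> forall sigma : R, 0 < sigma ->
         median (V sigma) <= (r + 2 * ln 2 - 2) * theta)].
Proof.
have decr sigma1 sigma2 : 0 < sigma1 -> sigma1 < sigma2 ->
    median (V sigma2) < median (V sigma1).
  move=> s1 s12; apply: (vg_median_decreasing hr htheta s1 s12); apply: hV => //.
  exact: lt_trans s12.
have lower sigma : 0 < sigma -> Num.max 0 ((r - 1) * theta) < median (V sigma).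
  move=> s0; rewrite gt_max (vg_median_gt0 hr htheta s0 (hV _ s0))/=.
  have [r1|r1] := ltP 1 r; first exact: (vg_median_gt hr htheta s0 (hV _ s0) r1).
  apply: (le_lt_trans _ (vg_median_gt0 hr htheta s0 (hV _ s0))).
  by rewrite pmulr_lle0// subr_le0.
have a0 : 0 < r / 2 by rewrite divr_gt0.
split=> //.
- move=> d' Omega' P' G gG sigma s0.
  exact: (vg_median_lt_gamma_median hr htheta s0 (hV _ s0) gG).
- set L := (X in _ --> X).
  have LE : L = Num.max 0 ((r - 1) * theta).
    rewrite /L; case: ltP => r1; first by rewrite max_r// mulr_ge0 ?subr_ge0// ltW.
    by rewrite max_l// pmulr_lle0// subr_le0.
  apply/cvgrPdist_lt => e e0.
  have Le0 : 0 < L + e by rewrite ltr_wpDl// LE le_max lexx.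
  have Ler : (r - 1) * theta < L + e.
    by apply: (@le_lt_trans _ _ L); rewrite ?ltrDl// LE le_max lexx orbT.
  have [s0 s00 Hs0] := vg_median_eventually_lt hr htheta Le0 Ler.
  near=> sigma.
  have ss : s0 < sigma by near: sigma; apply: nbhs_pinfty_gt; rewrite num_real.
  have sg0 : 0 < sigma by exact: lt_trans ss.
  have low := lower _ sg0; rewrite -LE in low.
  have up : median (V sigma) < L + e.
    exact: lt_trans (decr _ _ s00 ss) (Hs0 _ _ _ _ (hV _ s00)).
  rewrite distrC ger0_norm ?subr_ge0; first by rewrite ltrBlDl.
  exact: ltW.
- move=> sigma s0; split; first exact: lower.
  + pose y := r / 2 * expR (- (1 / (3 * (r / 2)))).
    have y0 : 0 < y by rewrite mulr_gt0// expR_gt0.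
    have -> : r * theta * expR (- (2 / (3 * r))) = 2 * theta * y.
      rewrite /y (_ : 1 / (3 * (r / 2)) = 2 / (3 * r)); first by field.
      by field; rewrite gt_eqF.
    apply: (vg_median_lt_of_gamma hr htheta s0 (hV _ s0) y0).
    exact: gamma_median_exp_bound.
  + rewrite (mulrAC r) ltr_pM2r//.
    have x0 : 0 < 2 / (3 * r) by rewrite divr_gt0// mulr_gt0.
    have expN_lt := expRN_lt_quadratic x0; rewrite -(ltr_pM2l hr) in expN_lt.
    rewrite (_ : r - 2 / 3 + _ = r * (1 - 2 / (3 * r) + (2 / (3 * r)) ^+ 2 / 2))//.
    by field; rewrite gt_eqF.
- move=> r2 sigma s0; have a1 : 1 <= r / 2 by lra.
  have l2 : 0 < ln 2 :> R by rewrite ln_gt0// ltr1n.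
  pose y := r / 2 - 1 + ln 2.
  have y0 : 0 < y by rewrite /y; lra.
  have -> : (r + 2 * ln 2 - 2) * theta = 2 * theta * y by rewrite /y; field.
  apply/ltW/(vg_median_lt_of_gamma hr htheta s0 (hV _ s0) y0).
  exact: gamma_median_linear_bound.
Unshelve. all: by end_near. Qed.
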